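(* Let $(T,(D_v)_{v\in T},(X_v)_{v\in T},(\Lambda_v)_{v\in T})$ be a decorated branching random walk with reproduction scheme $(\chi,\Lambda,D,(X_i)_{1\le i\le\chi(\mathbb{R})})$ satisfying Assumptions 1--6 listed in the context. Then, as $r\to\infty$, $$\mathbb{P}\Big(\sup_{v\in T}X_v>r\Big)\sim\frac{6\eta^2}{\sigma^2r^2}.$$
   Context: Let $\mathcal{U}=\bigcup_{n\ge0}\{1,2,\dots\}^n$ be the set of finite words ($\emptyset$ is the empty word, $|u|$ the length of $u$). A finite point process on $\mathbb{R}$ is a random finite counting measure; for a counting measure $\mu$, $\sup\mu$ is the supremum of its support, with $\sup\mu=-\infty$ if $\mu=0$. A reproduction scheme is $(\chi,\Lambda,D,(X_i)_{1\le i\le\chi(\mathbb{R})})$ where $\chi$ is a finite point process on $\mathbb{R}$, $(X_i)$ is a measurable enumeration of its atoms ($\chi=\sum_i\delta_{X_i}$), $\Lambda\ge0$ is a random variable with $\Lambda\ge\sup\chi$ a.s., and $D\ge0$ is a random variable; the joint law is otherwise arbitrary. The decorated branching random walk with this scheme is built from i.i.d. copies $(\chi_u,\Lambda^{(u)},D_u,(X^{(u)}_i)_{i})_{u\in\mathcal{U}}$ of the scheme: $T\subset\mathcal{U}$ is the random tree with $\emptyset\in T$ and $uj\in T$ iff $u\in T$ and $1\le j\le\chi_u(\mathbb{R})$; $X_\emptyset=0$, $X_{uj}=X_u+X^{(u)}_j$, and $\Lambda_u=X_u+\Lambda^{(u)}$. Assumptions: (1) $\mathbb{E}[\chi(\mathbb{R})]=1$;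 (2) $\mathbb{E}[\int x\,d\chi(x)]=0$; (3) $\mathbb{E}[\chi(\mathbb{R})^2]=\sigma^2+1\in(1,\infty)$; (4) $\mathbb{E}[\int x^2\,d\chi(x)]=\eta^2\in(0,\infty)$; (5) $\mathbb{P}(\Lambda>r)=o(r^{-4})$ as $r\to\infty$; (6) $\mathbb{E}[D]=1$. *)

(* Defs.v *)
From HB Require Export structures.
From mathcomp Require Export all_boot all_order all_algebra.
From mathcomp Require Export all_classical all_reals all_analysis.

Set Implicit Arguments.
Unset Strict Implicit.
Unset Printing Implicit Defensive.

Export Order.TTheory GRing.Theory Num.Theory.
Export numFieldNormedType.Exports.

Local Open Scope classical_set_scope.
Local Open Scope ring_scope.

(* A finite list of atoms: one value of the enumeration (X_i)_{1 <= i <= N},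
   where N = chi(R) is the length of the list. *)
Definition atom_seq (R : realType) : Type := seq R.

HB.instance Definition _ (R : realType) := Choice.on (atom_seq R).
HB.instance Definition _ (R : realType) :=
  isPointed.Build (atom_seq R) ([::] : seq R).

(* atom_seq R is the disjoint union over n of the spaces n.-tuple R = R^n, and
   it carries the sigma-algebra of that disjoint union: a set of lists is
   measurable iff, for every n, its part in R^n is (product-)Borel. *)
Definition atom_seq_measurable (R : realType) : set (set (atom_seq R)) :=
  [set A | forall n : nat,
    measurable ([set t : n.-tuple R | A (tval t)] : set (n.-tuple R))].

Lemma atom_seq_measurable0 (R : realType) : @atom_seq_measurable R set0.
Proof. by move=> n; exact: measurable0. Qed.

Lemma atom_seq_measurableC (R : realType) (A : set (atom_seq R)) :
  atom_seq_measurable A -> atom_seq_measurable (~` A).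
Proof. by move=> mA n; exact: measurableC (mA n). Qed.

Lemma atom_seq_measurable_bigcup (R : realType) (F : (set (atom_seq R))^nat) :
  (forall i, atom_seq_measurable (F i)) ->
  atom_seq_measurable (\bigcup_i F i).
Proof.
move=> mF n; rewrite [X in measurable X](_ : _ =
  \bigcup_i [set t : n.-tuple R | F i (tval t)]) //.
by apply: bigcupT_measurable => i; exact: mF.
Qed.

Definition atom_seq_display : measure_display -> measure_display.
Proof. exact. Qed.

HB.instance Definition _ (R : realType) :=
  @isMeasurable.Build (atom_seq_display default_measure_display) (atom_seq R)
    (@atom_seq_measurable R) (@atom_seq_measurable0 R)
    (@atom_seq_measurableC R) (@atom_seq_measurable_bigcup R).

(* The values of a reproduction scheme, in the order ((X_i)_i, Lambda, D). *)
Notation mark R := (atom_seq R * R * R)%type.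

Definition atoms (R : realType) (m : mark R) : seq R := m.1.1.
Definition bound (R : realType) (m : mark R) : R := m.1.2.
Definition decoration (R : realType) (m : mark R) : R := m.2.

(* The counting measure chi = \sum_i \d_(X_i). *)
Definition point_measure (R : realType) (m : mark R) :
    {measure set R -> \bar R} :=
  msum (fun i => \d_(nth 0 (atoms m) i)) (size (atoms m)).

Definition measure_support (R : realType) (mu : {measure set R -> \bar R}) :
    set R :=
  [set x | forall U : set R, open_nbhs x U -> (0 < mu U)%E].

(* ereal_sup set0 = -oo, hence measure_sup 0 = -oo. *)
Definition measure_sup (R : realType) (mu : {measure set R -> \bar R}) :
    \bar R :=
  ereal_sup (EFin @` measure_support mu).

Definition reproduction_scheme (R : realType) (d : measure_display)
    (Omega : measurableType d) (P : probability Omega R)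
    (Y : {RV P >-> mark R}) : Prop :=
  [/\ {ae P, forall w, 0 <= bound (Y w)},
      {ae P, forall w, (measure_sup (point_measure (Y w))
                          <= (bound (Y w))%:E)%E} &
      {ae P, forall w, 0 <= decoration (Y w)}].

(* Words of U. Letters are numbered from 0: the letter j stands for j + 1. *)
Definition word : Type := seq nat.

(* (Z u)_u are i.i.d. with the law of Y. The copies may live on another
   probability space than Y. *)
Definition iid_copies (R : realType)
    (d0 : measure_display) (Omega0 : measurableType d0)
    (P0 : probability Omega0 R) (Y : {RV P0 >-> mark R})
    (d : measure_display) (Omega : measurableType d)
    (P : probability Omega R) (Z : word -> {RV P >-> mark R}) : Prop :=
  (forall (u : word) (A : set (mark R)), measurable A ->
     distribution P (Z u) A = distribution P0 Y A) /\
  (forall (s : seq word) (A : word -> set (mark R)), uniq s ->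
     (forall u, measurable (A u)) ->
     P (\bigcap_(u in [set` s]) (Z u @^-1` A u)) =
     (\prod_(u <- s) P (Z u @^-1` A u))%E).

Section Tree.
Variables (R : realType) (Omega : Type) (Z : word -> Omega -> mark R).

Inductive tree (w : Omega) : word -> Prop :=
| tree_root : tree w [::]
| tree_child (u : word) (j : nat) :
    tree w u -> (j < size (atoms (Z u w)))%N -> tree w (rcons u j).

(* The displacements are summed over the strict prefixes take k u of u. *)
Definition position (u : word) (w : Omega) : R :=
  \sum_(k < size u) nth 0 (atoms (Z (take k u) w)) (nth 0%N u k).

Lemma position_root (w : Omega) : position [::] w = 0.
Proof. by rewrite /position big_ord0. Qed.

Lemma position_child (u : word) (j : nat) (w : Omega) :
  position (rcons u j) w = position u w + nth 0 (atoms (Z u w)) j.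
Proof.
rewrite /position size_rcons big_ord_recr /=; congr (_ + _); last first.
  by rewrite -cats1 take_size_cat// nth_cat ltnn subnn.
apply: eq_bigr => k _; rewrite -cats1 takel_cat; last exact/ltnW.
by rewrite nth_cat ltn_ord.
Qed.

Definition max_displacement (w : Omega) : \bar R :=
  ereal_sup [set (position v w)%:E | v in [set v | tree w v]].

End Tree.

(* The Landau notations =o_F and ~_F need a bundled filter. *)
Canonical pinfty_filter_on (R : realType) : filter_on R :=
  FilterType (pinfty_nbhs R) _.

(* Main.v *)
Require Import Defs.
From mathcomp Require Import measurable_realfun ring lra.

(** Let v(r) be the probability that some particle of the branching random walk
    sits beyond r, and let (X_1, ..., X_N) be the displacements of the children
    of the root.  For r >= 0 the walk stays below r iff, for each i, the subtree
    of the i-th child stays below r - X_i; these subtrees are independent of the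
    root and distributed as the whole tree, so that
       v(r) = E [1 - prod_i (1 - v(r - X_i))]   for r >= 0,
       v(r) = 1                                 for r < 0
    ([no_overshoot_branch], [tail_lt0]).  The asymptotics of v follow from this
    equation alone, of which the right-hand side is called [reproduce].

    Expanding the product and the displaced values of v to second order, with
    E N = 1, E sum X_i = 0, E sum X_i^2 = eta^2 and E N(N-1) = sigma^2, the
    equation becomes, formally, eta^2 v'' = sigma^2 v^2.  Its decaying solutions
    are c / (r + b)^2 with c = 6 eta^2 / sigma^2.  This is made rigorous by
    barriers.  If k > c, then k / s^2 is a strict supersolution for large s, and
    if k < c it is a strict subsolution ([reproduce_upper] and [upper_balance],
    [reproduce_lower] and [lower_balance]); suitably modified near the origin,
    these functions are compared with v ([upper_envelope], [lower_envelope]),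
    and k is then sent to c ([equiv_inv_sqr]).

    The comparison principle ([comparison]) uses that the population is critical
    and not deterministic.  If D is the supremum of u1 - u2 for a subsolution u1
    and a supersolution u2, one application of the equation bounds u1 - u2 by
    E [1 - (1 - D)^N] <= D - p D^2, where p = P(N >= 2) > 0; hence D <= 0.  The
    same inequality shows that v tends to 0 ([profile_vanishes]), which is what
    allows an upper barrier with small values to be put above v.

    The gain of a barrier at s is of order s^-4, so all errors have to be
    o(s^-4).  An atom beyond a fixed fraction of s is what the tail hypothesis on
    Lambda controls, as Lambda bounds the atoms.  The other errors come from
    families with many or remote atoms; as N and the X_i have only two moments,
    these are absorbed in the truncated moment
    E [(N^2 + sum X_i^2) 1_{N + sum |X_i| > K}], which is small for large K
    ([expect_truncated_moment]). *)

Set Implicit Arguments.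
Unset Strict Implicit.
Unset Printing Implicit Defensive.

Local Open Scope classical_set_scope.
Local Open Scope ring_scope.

(** * Products of numbers of the unit interval *)

Section prod.
Variables (R : realFieldType) (T : eqType).
Implicit Types (w : T -> R) (xs : seq T).

Lemma prod_1B_itv w xs : {in xs, forall a, 0 <= w a <= 1} ->
  0 <= \prod_(a <- xs) (1 - w a) <= 1.
Proof.
elim: xs => [|a xs IH] h; first by rewrite big_nil ler01 lexx.
have /andP[w0 w1] := h a (mem_head _ _).
have /andP[p0 p1] : 0 <= \prod_(a <- xs) (1 - w a) <= 1.
  by apply: IH => b bxs; apply: h; rewrite inE bxs orbT.
rewrite big_cons mulr_ge0 ?subr_ge0//= mulr_ile1 ?subr_ge0//.
by rewrite lerBlDr lerDl.
Qed.

Lemma union_bound w xs : {in xs, forall a, 0 <= w a <= 1} ->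
  1 - \prod_(a <- xs) (1 - w a) <= \sum_(a <- xs) w a.
Proof.
elim: xs => [|a xs IH] h; first by rewrite !big_nil subrr.
have hxs : {in xs, forall a, 0 <= w a <= 1}.
  by move=> b bxs; apply: h; rewrite inE bxs orbT.
have /andP[w0 w1] := h a (mem_head _ _).
have /andP[p0 p1] := prod_1B_itv hxs; have := IH hxs.
rewrite !big_cons; set p := \prod_(_ <- _) _ in p0 p1 *.
set s := \sum_(_ <- _) _ => ps; nra.
Qed.

(** The lower bound is Bernoulli's inequality; n^2 in place of n(n-1)/2 keeps the
    induction short and only enters through the small factor k y of
    [bonferroni_le]. *)
Lemma exprB1_le (y : R) n : 0 <= y <= 1 ->
  1 - n%:R * y <= (1 - y) ^+ n <= 1 - n%:R * y + n%:R ^+ 2 * y ^+ 2.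
Proof.
move=> /andP[y0 y1].
elim: n => [|n /andP[IH1 IH2]]; first
  by rewrite expr0 !mul0r subr0 expr0n mul0r addr0 lexx.
have n0 : 0 <= n%:R :> R by [].
rewrite exprS -natr1.
move: IH1 IH2 n0; move: (_ ^+ n) (n%:R) => p m IH1 IH2 n0.
have yy : 0 <= y ^+ 2 by exact: sqr_ge0.
have my : 0 <= m * y ^+ 2 by exact: mulr_ge0.
have y1' : 0 <= 1 - y by lra.
have e1 : 0 <= (1 - y) * (p - (1 - m * y)) by apply: mulr_ge0 => //; lra.
have e2 : 0 <= (1 - y) * (1 - m * y + m ^+ 2 * y ^+ 2 - p).
  by apply: mulr_ge0 => //; lra.
have e3 : 0 <= y * (m ^+ 2 * y ^+ 2) by rewrite !mulr_ge0// sqr_ge0.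
apply/andP; split; nra.
Qed.

(** Second Bonferroni bound without a third moment.  Adding one more factor costs
    w a * (1 - p), where 1 - p is at least 1 - (1 - y)^m >= m y (1 - k y) when
    all values are at least y and there are at most k of them; summing over m
    gives the number of pairs. *)
Lemma bonferroni_le w xs (y k : R) : 0 <= y <= 1 ->
  {in xs, forall a, y <= w a <= 1} -> (size xs)%:R <= k ->
  1 - \prod_(a <- xs) (1 - w a) <=
  \sum_(a <- xs) w a -
    (1 - k * y) * y ^+ 2 * (((size xs)%:R ^+ 2 - (size xs)%:R) / 2).
Proof.
move=> y01; have /andP[y0 y1] := y01.
elim: xs => [|a xs IH] h sk; first
  by rewrite !big_nil /= expr0n !subrr mul0r mulr0 subr0.
have hxs : {in xs, forall a, y <= w a <= 1}.
  by move=> b bxs; apply: h; rewrite inE bxs orbT.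
have hxs0 : {in xs, forall a, 0 <= w a <= 1}.
  by move=> b /hxs/andP[? ?]; apply/andP; split => //; apply: le_trans y0 _.
have /andP[w0 w1] := h a (mem_head _ _).
have /andP[p0 p1] := prod_1B_itv hxs0.
move: sk; rewrite !big_cons /= -natr1 => sk.
have := IH hxs _; set p := \prod_(_ <- _) _ in p0 p1 *.
set s := \sum_(_ <- _) _; move/(_ ltac:(lra)) => IHp.
have : p <= (1 - y) ^+ (size xs).
  rewrite -iter_mulr_1 -(count_predT xs) -big_const_seq /p.
  rewrite big_seq [leRHS]big_seq; apply: ler_prod => b bxs.
  by have /andP[? ?] := hxs _ bxs; apply/andP; split; lra.
have /andP[_ ub] := exprB1_le (size xs) y01.
move=> /le_trans => /(_ _ ub) => {ub} ub.
have m0 : 0 <= (size xs)%:R :> R by [].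
move: (size xs)%:R m0 sk IHp ub => m m0 sk IHp ub.
have y2 : 0 <= y ^+ 2 by exact: sqr_ge0.
have ub' : (1 - k * y) * y * m <= 1 - p.
  have : 0 <= (m * y ^+ 2) * (k - m) by rewrite !mulr_ge0//; lra.
  nra.
have : (1 - k * y) * y ^+ 2 * m <= w a * (1 - p); last by nra.
have [ky|ky] := leP (k * y) 1.
  have : 0 <= (w a - y) * (1 - p) by rewrite mulr_ge0//; lra.
  nra.
have : 0 <= w a * (1 - p) by rewrite mulr_ge0//; lra.
have : 0 <= (k * y - 1) * y ^+ 2 * m by rewrite !mulr_ge0//; lra.
nra.
Qed.

(** First Bonferroni bound from below: the same recursion as in [bonferroni_le],
    with 1 - p bounded above by the sum of the previous values. *)
Lemma bonferroni_ge w xs (z : R) :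
  {in xs, forall a, 0 <= w a <= 1} -> {in xs, forall a, w a <= z} ->
  \sum_(a <- xs) w a - z ^+ 2 * (((size xs)%:R ^+ 2 - (size xs)%:R) / 2) <=
  1 - \prod_(a <- xs) (1 - w a).
Proof.
elim: xs => [|a xs IH] h hz; first
  by rewrite !big_nil /= expr0n !subrr mul0r mulr0 subr0.
have hxs : {in xs, forall a, 0 <= w a <= 1}.
  by move=> b bxs; apply: h; rewrite inE bxs orbT.
have hzxs : {in xs, forall a, w a <= z}.
  by move=> b bxs; apply: hz; rewrite inE bxs orbT.
have /andP[w0 w1] := h a (mem_head _ _).
have wz := hz a (mem_head _ _).
have /andP[p0 p1] := prod_1B_itv hxs.
have ub := union_bound hxs.
rewrite !big_cons /= -natr1.
have := IH hxs hzxs; set p := \prod_(_ <- _) _ in p0 p1 ub *.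
have m0 : 0 <= (size xs)%:R :> R by [].
have : \sum_(a <- xs) w a <= (size xs)%:R * z.
  rewrite mulr_natl -iter_addr_0 -(count_predT xs) -big_const_seq.
  rewrite big_seq [leRHS]big_seq.
  by apply: ler_sum => b /hzxs.
move: ub; set s := \sum_(_ <- _) _.
move: (size xs)%:R m0 => m m0 ub sz IHp.
have : w a * (1 - p) <= z * (m * z) by apply: ler_pM; lra.
nra.
Qed.

(** The left-hand side is greatest when every a t is 1 and every b t is 1 - D:
    1 - (1 - D)^n is then the probability that one of n independent events of
    probability D occurs. *)
Lemma prod_diff_le (a b : T -> R) xs (D : R) : 0 <= D <= 1 ->
  {in xs, forall t, 0 <= a t <= 1} -> {in xs, forall t, 0 <= b t <= 1} ->
  {in xs, forall t, a t - b t <= D} ->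
  \prod_(t <- xs) a t - \prod_(t <- xs) b t <= 1 - (1 - D) ^+ size xs.
Proof.
move=> /andP[D0 D1].
elim: xs => [|t xs IH] ha hb hD; first by rewrite !big_nil /= subrr.
have sub (Q : T -> Prop) : {in t :: xs, forall b, Q b} -> {in xs, forall b, Q b}.
  by move=> HQ c cxs; apply: HQ; rewrite inE cxs orbT.
have := IH (sub _ ha) (sub _ hb) (sub _ hD).
have /andP[a0 a1] := ha t (mem_head _ _).
have /andP[b0 b1] := hb t (mem_head _ _).
have Dt := hD t (mem_head _ _).
rewrite !big_cons /= exprS.
have pr (c : T -> R) : {in xs, forall t, 0 <= c t <= 1} ->
    0 <= \prod_(t <- xs) c t <= 1.
  move=> hc; under eq_bigr do rewrite -[c _](subKr 1).
  by apply: prod_1B_itv => u /hc /andP[? ?]; apply/andP; split; lra.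
have /andP[A0 A1] := pr _ (sub _ ha).
have /andP[B0 B1] := pr _ (sub _ hb).
have E0 : 0 <= (1 - D) ^+ size xs by rewrite exprn_ge0// subr_ge0.
have E1 : (1 - D) ^+ size xs <= 1 by rewrite exprn_ile1 ?subr_ge0// lerBlDr lerDl.
move: (\prod_(t <- xs) a t) (\prod_(t <- xs) b t) (_ ^+ _) A0 A1 B0 B1 E0 E1.
move=> A B E A0 A1 B0 B1 E0 E1 AB.
move: (a t) (b t) a0 a1 b0 b1 Dt => p q p0 p1 q0 q1 pq.
have [h|h] := leP p D.
  have : p * A <= D by nra.
  have : 0 <= q * B by exact: mulr_ge0.
  have : 0 <= (1 - D) * (1 - E) by rewrite mulr_ge0//; lra.
  nra.
have [h'|h'] := leP A (1 - E).
  have : p * A <= 1 - E by nra.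
  have : 0 <= q * B by exact: mulr_ge0.
  have : 0 <= D * E by exact: mulr_ge0.
  nra.
have : (p - D) * (A - (1 - E)) <= q * B by apply: ler_pM; lra.
have : 0 <= (1 - p) * (1 - E) by rewrite mulr_ge0//; lra.
have : 0 <= D * (1 - A) by rewrite mulr_ge0//; lra.
nra.
Qed.

End prod.

(** * Scalar expansions *)

Section scalar.
Variable R : realFieldType.

(** The strict loss D^2 for families of at least two children is what makes the
    reproduction equation contract. *)
Lemma exprB1_le_ge2 (q : R) n : 0 <= q <= 1 ->
  1 - (1 - q) ^+ n <= n%:R * q - (2 <= n)%:R * q ^+ 2.
Proof.
move=> q01; have /andP[q0 q1] := q01; case: n => [|[|n]] /=.
- by rewrite expr0; nra.
- by rewrite expr1; nra.
have /andP[lb _] := exprB1_le n q01.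
rewrite !exprS -2!natr1.
have n0 : 0 <= n%:R :> R by [].
move: (_ ^+ n) (n%:R) lb n0 => p m lb n0.
have : (1 - q) * (1 - q) * (1 - m * q) <= (1 - q) * (1 - q) * p.
  by rewrite ler_wpM2l// mulr_ge0; lra.
have : 0 <= m * q * (1 - (1 - q) * (1 - q)) by rewrite !mulr_ge0//; nra.
nra.
Qed.

(** The two alternatives for c serve atoms of bounded size, where c is small, and
    all others, where c = 1; the remainder t^3 (4 - 3 t) / (1 - t)^2 is
    nonpositive for t <= 0. *)
Lemma inv_sqr_taylor_le (t c : R) : t <= 2^-1 -> `|t| <= c \/ 1 <= c -> 0 <= c ->
  (1 - t) ^- 2 <= 1 + 2 * t + 3 * t ^+ 2 + 16 * t ^+ 2 * c.
Proof.
move=> t2 tc c0.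
have t1 : 0 < (1 - t) ^+ 2 by rewrite exprn_gt0//; lra.
rewrite -[leLHS]mul1r ler_pdivrMr//.
have t20 : 0 <= t ^+ 2 by exact: sqr_ge0.
have E : (1 + 2 * t + 3 * t ^+ 2 + 16 * t ^+ 2 * c) * (1 - t) ^+ 2 - 1 =
  t ^+ 2 * (16 * c * (1 - t) ^+ 2 - t * (4 - 3 * t)) by ring.
rewrite -subr_ge0 E mulr_ge0//.
have [tn|tp] := leP t 0; first by nra.
have tc' : t <= c by case: tc => [|?]; [rewrite gtr0_norm|lra].
have : 2^-1 * 2^-1 <= (1 - t) ^+ 2 by rewrite expr2; apply: ler_pM; lra.
nra.
Qed.

Lemma inv_sqr_taylor_ge (t c : R) : t <= 2^-1 -> `|t| <= c \/ 1 <= c -> 0 <= c ->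
  1 + 2 * t + 3 * t ^+ 2 - 4 * t ^+ 2 * c <= (1 - t) ^- 2.
Proof.
move=> t2 tc c0.
have t1 : 0 < (1 - t) ^+ 2 by rewrite exprn_gt0//; lra.
rewrite -[leRHS]mul1r ler_pdivlMr//.
have t20 : 0 <= t ^+ 2 by exact: sqr_ge0.
have E : 1 - (1 + 2 * t + 3 * t ^+ 2 - 4 * t ^+ 2 * c) * (1 - t) ^+ 2 =
  t ^+ 2 * (4 * c * (1 - t) ^+ 2 + t * (4 - 3 * t)) by ring.
rewrite -subr_ge0 E mulr_ge0//.
have [tn|tp] := leP 0 t; first by nra.
have : - t <= c \/ 1 <= c by case: tc; [rewrite ltr0_norm//; left|right].
case => h.
  have : 0 <= (c + t) * (1 - t) ^+ 2 by rewrite mulr_ge0// ?sqr_ge0//; lra.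
  have : 0 <= - t * (1 - t) ^+ 2 by rewrite mulr_ge0// ?sqr_ge0//; lra.
  nra.
have : 0 <= (c - 1) * (1 - t) ^+ 2 by rewrite mulr_ge0// ?sqr_ge0//; lra.
nra.
Qed.

End scalar.

(** * Measurable functions of a list of atoms *)

Section atoms_measurable.
Context (R : realType).

(** The sigma-algebra on lists is that of a disjoint union of powers of R, so
    measurability is checked length by length. *)
Lemma measurable_atom_seqP d (T : measurableType d) (F : atom_seq R -> T) :
  (forall n, measurable_fun [set: n.-tuple R] (fun t => F (tval t))) ->
  measurable_fun [set: atom_seq R] F.
Proof.
move=> mF _ A mA; rewrite setTI -[measurable _]/(atom_seq_measurable _) => n.
by have := mF n measurableT A mA; rewrite setTI.
Qed.

Section atoms_fun.
Context d (T : measurableType d) (xs : T -> atom_seq R).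
Hypothesis mxs : measurable_fun setT xs.

Lemma measurable_atoms_fun (F : seq R -> R) :
  (forall n, measurable_fun [set: n.-tuple R] (fun t => F (tval t))) ->
  measurable_fun setT (fun w => F (xs w)).
Proof.
by move=> mF; exact: (measurableT_comp (measurable_atom_seqP mF) mxs).
Qed.

Lemma measurable_sum_atoms (g : R -> R) : measurable_fun setT g ->
  measurable_fun setT (fun w => \sum_(a <- (xs w : seq R)) g a).
Proof.
move=> mg; apply: (@measurable_atoms_fun (fun x => \sum_(a <- x) g a)) => n.
under eq_fun do rewrite big_tuple.
by apply: measurable_sum => i; exact: (measurableT_comp mg (measurable_tnth i)).
Qed.

Lemma measurable_prod_atoms (g : R -> R) : measurable_fun setT g ->
  measurable_fun setT (fun w => \prod_(a <- (xs w : seq R)) g a).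
Proof.
move=> mg; apply: (@measurable_atoms_fun (fun x => \prod_(a <- x) g a)) => n.
under eq_fun do rewrite big_tuple.
by apply: measurable_prod => i _; exact: (measurableT_comp mg (measurable_tnth i)).
Qed.

Lemma measurable_size_atoms : measurable_fun setT (fun w => size (xs w)).
Proof.
apply: (measurableT_comp _ mxs).
apply: measurable_atom_seqP => n; under eq_fun do rewrite size_tuple.
exact: measurable_cst.
Qed.

End atoms_fun.

Lemma measurable_natr d (T : measurableType d) (f : T -> nat) :
  measurable_fun setT f -> measurable_fun setT (fun x => (f x)%:R : R).
Proof.
have mR : measurable_fun setT (fun n : nat => n%:R : R) by [].
by move=> mf; exact: (measurableT_comp mR mf).
Qed.

Lemma measurable_boolr d (T : measurableType d) (f : T -> bool) :
  measurable_fun setT f -> measurable_fun setT (fun x => (f x)%:R : R).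
Proof.
have mR : measurable_fun setT (fun b : bool => b%:R : R) by [].
by move=> mf; exact: (measurableT_comp mR mf).
Qed.

End atoms_measurable.

(** * Expectation of real functions *)

Section real_expectation.
Context d (Omega : measurableType d) (R : realType) (P : probability Omega R).
Implicit Types f g : Omega -> R.

Definition expect f : R := \int[P]_w f w.
Definition Rintegrable f := P.-integrable setT (EFin \o f).

Lemma RintegrableD f g : Rintegrable f -> Rintegrable g ->
  Rintegrable (fun w => f w + g w).
Proof. exact: integrableD. Qed.

Lemma RintegrableB f g : Rintegrable f -> Rintegrable g ->
  Rintegrable (fun w => f w - g w).
Proof. exact: integrableB. Qed.

Lemma RintegrableZ (k : R) f : Rintegrable f -> Rintegrable (fun w => k * f w).
Proof. exact: integrableZl. Qed.

Lemma Rintegrable_le f g : measurable_fun setT f ->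
  (forall w, `|f w| <= g w) -> Rintegrable g -> Rintegrable f.
Proof.
move=> mf fg; apply: le_integrable => //; first exact/measurable_EFinP.
by move=> w _ /=; rewrite lee_fin (le_trans (fg w))// ler_norm.
Qed.

Lemma Rintegrable_cst (k : R) : Rintegrable (fun=> k).
Proof. exact: finite_measure_integrable_cst. Qed.

Lemma Rintegrable_bounded f : measurable_fun setT f ->
  (forall w, 0 <= f w <= 1) -> Rintegrable f.
Proof.
move=> mf f01; apply: (Rintegrable_le mf _ (Rintegrable_cst 1)) => w.
by have /andP[? ?] := f01 w; rewrite ger0_norm.
Qed.

Lemma expectD f g : Rintegrable f -> Rintegrable g ->
  expect (fun w => f w + g w) = expect f + expect g.
Proof. exact: RintegralD. Qed.

Lemma expectB f g : Rintegrable f -> Rintegrable g ->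
  expect (fun w => f w - g w) = expect f - expect g.
Proof. exact: RintegralB. Qed.

Lemma expectZ (k : R) f : Rintegrable f -> 
  expect (fun w => k * f w) = k * expect f.
Proof. exact: RintegralZl. Qed.

Lemma expect_cst (k : R) : expect (fun=> k) = k.
Proof.
rewrite /expect Rintegral_cst// -[RHS]mulr1; congr (k * _).
exact: (congr1 fine (probability_setT P)).
Qed.

Lemma le_expect f g : Rintegrable f -> Rintegrable g ->
  (forall w, f w <= g w) -> expect f <= expect g.
Proof. by move=> *; apply: le_Rintegral. Qed.

Lemma expect_ge0 f : (forall w, 0 <= f w) -> 0 <= expect f.
Proof. by move=> *; apply: Rintegral_ge0. Qed.

(** Uniform integrability of a single integrable function, by dominated
    convergence along integer thresholds. *)
Lemma expect_truncation f (q : Omega -> R) (e : R) : 0 < e ->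
  Rintegrable f -> (forall w, 0 <= f w) -> measurable_fun setT q ->
  exists2 K : R, 1 <= K & expect (fun w => f w * (K < q w)%R%:R) <= e.
Proof.
move=> e0 fi f0 mq.
have mf : measurable_fun setT f by move/integrableP : fi => [/measurable_EFinP].
have mfq (K : R) : measurable_fun setT (fun w => f w * (K < q w)%R%:R).
  apply: measurable_funM => //; apply: measurable_boolr.
  exact: measurable_fun_ltr.
have fq (K : R) w : `|f w * (K < q w)%R%:R| <= f w.
  by rewrite ger0_norm ?mulr_ge0//; case: ltP => _; rewrite ?mulr1// mulr0.
have [] := @dominated_convergence _ _ _ P setT measurableT
  (fun n w => (f w * (n.+1%:R < q w)%R%:R)%:E) (cst 0%E) (EFin \o f).
- by move=> n; exact/measurable_EFinP.
- exact: measurable_cst.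
- apply: aeW => w _; apply: cvg_near_cst; near=> n.
  rewrite ltNge (_ : q w <= n.+1%:R) ?mulr0//.
  have : (Num.truncn (`|q w|) < n)%N by near: n; exact: nbhs_infty_gt.
  move=> h; rewrite (le_trans (ler_norm _))//.
  rewrite (le_trans (ltW (Num.Theory.truncnS_gt _)))//.
  by rewrite ler_nat ltnW.
- exact: fi.
- by apply: aeW => w n _; rewrite lee_fin.
move=> _ _; rewrite integral0 => /fine_cvgP[_ /cvgr_lt/(_ e e0)].
case=> n _ /(_ n (leqnn _)) /= h.
by exists n.+1%:R; rewrite ?ler1n// ltW.
Unshelve. all: by end_near.
Qed.

End real_expectation.

(** * Expansion of the equation for a given family of atoms *)

Section pointwise.
Variable R : realFieldType.
Implicit Types (xs : seq R) (w : R -> R) (s k K c r : R).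

Definition natoms xs : R := (size xs)%:R.
Definition power_sum n xs : R := \sum_(a <- xs) a ^+ n.
(** A single quantity bounding both the number and the sizes of the atoms, so that
    one threshold controls all truncations. *)
Definition excess xs : R := natoms xs + \sum_(a <- xs) `|a|.
Definition truncated_moment K xs : R :=
  (natoms xs ^+ 2 + power_sum 2 xs) * (K < excess xs)%R%:R.
Definition jump s xs : R := (has (fun a => s < a)%R xs)%:R.

Lemma power_sum2_ge0 xs : 0 <= power_sum 2 xs.
Proof. by apply: sumr_ge0 => a _; rewrite sqr_ge0. Qed.

Lemma truncated_moment_ge0 K xs : 0 <= truncated_moment K xs.
Proof. by rewrite mulr_ge0// addr_ge0 ?sqr_ge0// power_sum2_ge0. Qed.

Lemma natoms_sqr xs : natoms xs <= natoms xs ^+ 2.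
Proof.
rewrite /natoms -natrX ler_nat; case: (size xs) => // n.
by rewrite -mulnn leq_pmulr.
Qed.

Lemma le_excess xs a : a \in xs -> `|a| <= excess xs.
Proof.
move=> axs; rewrite /excess (perm_big _ (perm_to_rem axs)) big_cons.
by rewrite addrCA lerDl addr_ge0// sumr_ge0.
Qed.

Lemma natoms_le_excess xs : natoms xs <= excess xs.
Proof. by rewrite lerDl sumr_ge0. Qed.

Lemma excess_jump s K xs : K <= s -> has (fun a => s < a)%R xs -> K < excess xs.
Proof.
move=> Ks /hasP[a axs sa]; apply: (lt_le_trans _ (le_excess axs)).
by rewrite (le_lt_trans Ks)// (lt_le_trans sa)// ler_norm.
Qed.

Lemma sum_quadratic xs (x y z : R) :
  \sum_(a <- xs) (x + y * a + z * a ^+ 2) =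
  x * natoms xs + y * power_sum 1 xs + z * power_sum 2 xs.
Proof.
rewrite !big_split/= -!mulr_sumr; congr (_ + _ + _).
by rewrite big_const_seq iter_addr_0 count_predT mulr_natr.
Qed.

Lemma inv_sqr_scale k s a : 0 < s -> k / (s - a) ^+ 2 = k / s ^+ 2 * (1 - a / s) ^- 2.
Proof.
move=> s0; rewrite -mulrA -invfM -exprMn mulrBr mulr1 mulrCA divff ?mulr1//.
exact: lt0r_neq0.
Qed.

Lemma sum_inv_sqr_le xs s k c : 0 < s -> 0 <= k -> 0 <= c ->
  {in xs, forall a, a <= s / 2} -> {in xs, forall a, `|a| / s <= c} \/ 1 <= c ->
  \sum_(a <- xs) k / (s - a) ^+ 2 <=
  k / s ^+ 2 * (natoms xs + 2 / s * power_sum 1 xs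
                + (3 + 16 * c) / s ^+ 2 * power_sum 2 xs).
Proof.
move=> s0 k0 c0 xs2 xsc.
have := sum_quadratic xs 1 (2 / s) ((3 + 16 * c) / s ^+ 2).
rewrite mul1r => <-; rewrite mulr_sumr big_seq [leRHS]big_seq.
apply: ler_sum => a axs; rewrite inv_sqr_scale// ler_wpM2l//.
  by rewrite divr_ge0// sqr_ge0.
rewrite (le_trans (@inv_sqr_taylor_le _ (a / s) c _ _ c0))//.
- by rewrite ler_pdivrMr// mulrC; exact: xs2.
- case: xsc => [xsc|]; [left|by right].
  by rewrite normrM normfV (gtr0_norm s0) xsc.
- by rewrite le_eqVlt; apply/orP; left; apply/eqP; field; exact: lt0r_neq0.
Qed.

Lemma sum_inv_sqr_ge xs s k c : 0 < s -> 0 <= k -> 0 <= c ->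
  {in xs, forall a, a <= s / 2} -> {in xs, forall a, `|a| / s <= c} \/ 1 <= c ->
  k / s ^+ 2 * (natoms xs + 2 / s * power_sum 1 xs
                + (3 - 4 * c) / s ^+ 2 * power_sum 2 xs) <=
  \sum_(a <- xs) k / (s - a) ^+ 2.
Proof.
move=> s0 k0 c0 xs2 xsc.
have := sum_quadratic xs 1 (2 / s) ((3 - 4 * c) / s ^+ 2).
rewrite mul1r => <-; rewrite mulr_sumr big_seq [leRHS]big_seq.
apply: ler_sum => a axs; rewrite inv_sqr_scale// ler_wpM2l//.
  by rewrite divr_ge0// sqr_ge0.
rewrite (le_trans _ (@inv_sqr_taylor_ge _ (a / s) c _ _ c0))//.
- by rewrite le_eqVlt; apply/orP; left; apply/eqP; field; exact: lt0r_neq0.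
- by rewrite ler_pdivrMr// mulrC; exact: xs2.
- case: xsc => [xsc|]; [left|by right].
  by rewrite normrM normfV (gtr0_norm s0) xsc.
Qed.

(** On families with excess at most K all atoms are small compared with s: the
    linear terms expand with error K / s and [bonferroni_le] gives the pairs.  On
    the others the truncated moment is N^2 + sum X_i^2, which dominates the
    missing pairs and the remainders.  When some atom exceeds s / 2 the left-hand
    side is at most 1, and the quadratic polynomial on the right-hand side stays
    nonnegative since 1 + 2 t + 3 t^2 > 0 for all t. *)
Lemma upper_pointwise xs w r s k K (y := k / (s + K) ^+ 2) :
  0 <= k -> 1 <= K -> 2 * K <= s -> K * y <= 1 ->
  (forall t, 0 <= w t <= 1) ->
  (forall a, a <= s / 2 -> w (r - a) <= k / (s - a) ^+ 2) ->
  (forall a, `|a| <= K -> y <= w (r - a)) ->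
  1 - \prod_(a <- xs) (1 - w (r - a)) <=
  jump (s / 2) xs + k / s ^+ 2 * (natoms xs + 2 / s * power_sum 1 xs
     + (3 + 16 * (K / s)) / s ^+ 2 * power_sum 2 xs
     + 16 / s ^+ 2 * truncated_moment K xs)
  - (1 - K * y) * y ^+ 2 / 2 * (natoms xs ^+ 2 - natoms xs)
  + y ^+ 2 / 2 * truncated_moment K xs.
Proof.
move=> k0 K1 Ks Ky w01 wle wge.
have s0 : 0 < s by lra.
have y0 : 0 <= y by rewrite divr_ge0// sqr_ge0.
have y1 : y <= 1 by nra.
have ks0 : 0 <= k / s ^+ 2 by rewrite divr_ge0// sqr_ge0.
have w01' : {in xs, forall a, 0 <= w (r - a) <= 1} by [].
have Ks0 : 0 <= K / s by rewrite divr_ge0; lra.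
have s20 : 0 < s ^+ 2 by rewrite exprn_gt0.
have N0 : 0 <= natoms xs by [].
have NN := natoms_sqr xs.
have S20 := power_sum2_ge0 xs.
(* 1 + 2 t + 3 t^2 = (1 + t)^2 + 2 t^2 *)
have S0 : 0 <= natoms xs + 2 / s * power_sum 1 xs + 3 / s ^+ 2 * power_sum 2 xs.
  have := sum_quadratic xs 1 (2 / s) (3 / s ^+ 2); rewrite mul1r => <-.
  apply: sumr_ge0 => a _.
  suff -> : 1 + 2 / s * a + 3 / s ^+ 2 * a ^+ 2 = (1 + a / s) ^+ 2 + 2 * (a / s) ^+ 2.
    by rewrite addr_ge0 ?sqr_ge0// mulr_ge0 ?sqr_ge0.
  by field; exact: lt0r_neq0.
have C0 : 0 <= 16 * (K / s) / s ^+ 2 * power_sum 2 xs.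
  by rewrite mulr_ge0// divr_ge0 ?sqr_ge0// mulr_ge0.
have E3 : (3 + 16 * (K / s)) / s ^+ 2 * power_sum 2 xs =
  3 / s ^+ 2 * power_sum 2 xs + 16 * (K / s) / s ^+ 2 * power_sum 2 xs by ring.
have Y2 : 0 <= y ^+ 2 / 2 by rewrite divr_ge0// sqr_ge0.
have [QK|QK] := ltP K (excess xs); last first.
  have -> : truncated_moment K xs = 0 by rewrite /truncated_moment ltNge QK mulr0.
  have hj : ~~ has (fun a => s / 2 < a)%R xs.
    apply/negP => /(@excess_jump (s / 2) K xs ltac:(lra)).
    by rewrite ltNge QK.
  have aK a : a \in xs -> `|a| <= K by move=> /le_excess /le_trans; apply.
  rewrite /jump (negbTE hj) add0r !mulr0 !addr0.
  have y01 : 0 <= y <= 1 by rewrite y0.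
  have wy1 : {in xs, forall a, y <= w (r - a) <= 1}.
    move=> a axs; rewrite wge ?aK//=.
    by have /andP[] := w01 (r - a).
  have h := bonferroni_le y01 wy1 (le_trans (natoms_le_excess xs) QK).
  apply: (le_trans h).
  rewrite -/(natoms xs) lerD//; last first.
    by rewrite le_eqVlt; apply/orP; left; apply/eqP; field.
  apply: (@le_trans _ _ (\sum_(a <- xs) k / (s - a) ^+ 2)).
    rewrite big_seq [leRHS]big_seq; apply: ler_sum => a /aK aK'.
    by apply: wle; have := ler_norm a; lra.
  apply: sum_inv_sqr_le => //.
    by move=> a /aK ?; have := ler_norm a; lra.
  by left => a /aK ?; rewrite ler_pM2r// invr_gt0.
have TE : truncated_moment K xs = natoms xs ^+ 2 + power_sum 2 xs.
  by rewrite /truncated_moment QK mulr1.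
(* the pairs missing on families of large excess are paid by T *)
have Y : 0 <= - ((1 - K * y) * y ^+ 2 / 2 * (natoms xs ^+ 2 - natoms xs))
  + y ^+ 2 / 2 * truncated_moment K xs.
  rewrite TE.
  have : (1 - K * y) * (natoms xs ^+ 2 - natoms xs) <= natoms xs ^+ 2 + power_sum 2 xs.
    have : 0 <= K * y * (natoms xs ^+ 2 - natoms xs).
      by apply: mulr_ge0; [apply: mulr_ge0; lra|lra].
    lra.
  move=> /(ler_wpM2l Y2) h; rewrite addrC subr_ge0 (le_trans _ h)// le_eqVlt.
  by apply/orP; left; apply/eqP; ring.
rewrite -addrA (le_trans _ (lerD (lexx _) Y))// addr0.
rewrite /jump; case: (boolP (has _ _)) => hj /=.
  apply: (@le_trans _ _ 1); first by have /andP[] := prod_1B_itv w01'; lra.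
  rewrite lerDl; apply: mulr_ge0 => //; rewrite E3.
  have : 0 <= 16 / s ^+ 2 * truncated_moment K xs.
    apply: mulr_ge0; last exact: truncated_moment_ge0.
    by apply: divr_ge0 => //; exact: ltW.
  lra.
rewrite add0r; apply: (le_trans (union_bound w01')).
have aS a : a \in xs -> a <= s / 2 by move=> /(hasPn hj); rewrite -leNgt.
apply: (@le_trans _ _ (\sum_(a <- xs) k / (s - a) ^+ 2)).
  by rewrite big_seq [leRHS]big_seq; apply: ler_sum => a /aS; exact: wle.
apply: (le_trans (@sum_inv_sqr_le xs s k 1 s0 k0 ler01 aS _)); first by right.
rewrite ler_wpM2l// E3 TE.
have -> : (3 + 16 * 1) / s ^+ 2 * power_sum 2 xs =
  3 / s ^+ 2 * power_sum 2 xs + 16 / s ^+ 2 * power_sum 2 xs by ring.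
have : 0 <= 16 / s ^+ 2 * natoms xs ^+ 2.
  by apply: mulr_ge0; [apply: divr_ge0 => //; exact: ltW|exact: sqr_ge0].
rewrite (mulrDr (16 / s ^+ 2)); lra.
Qed.

(** Same dichotomy as in [upper_pointwise].  When an atom exceeds delta * s the
    left-hand side is made nonpositive: 2 N <= s^2 + N^2 / s^2 charges the number
    of atoms to the jump, whose probability is o(s^-4), and to the truncated
    moment. *)
Lemma lower_pointwise xs w r s k K (delta : R) :
  0 <= k -> 1 <= K -> 0 < delta -> delta <= 2^-1 -> K <= delta * s ->
  (forall t, 0 <= w t <= 1) ->
  (forall a, a <= delta * s -> w (r - a) = k / (s - a) ^+ 2) ->
  k / s ^+ 2 * (natoms xs + 2 / s * power_sum 1 xs
     + (3 - 4 * (K / s)) / s ^+ 2 * power_sum 2 xs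
     - 9 / s ^+ 2 * truncated_moment K xs - s ^+ 2 * jump (delta * s) xs)
  - (k / (s ^+ 2 * (1 - delta) ^+ 2)) ^+ 2 / 2 * (natoms xs ^+ 2 - natoms xs)
  <= 1 - \prod_(a <- xs) (1 - w (r - a)).
Proof.
move=> k0 K1 d0 d2 Ks w01 wE.
have s0 : 0 < s by rewrite -(pmulr_rgt0 _ d0); lra.
have ks0 : 0 <= k / s ^+ 2 by rewrite divr_ge0// sqr_ge0.
have w01' : {in xs, forall a, 0 <= w (r - a) <= 1} by [].
have Ks0 : 0 <= K / s by rewrite divr_ge0; lra.
have s20 : 0 < s ^+ 2 by rewrite exprn_gt0.
have N0 : 0 <= natoms xs by [].
have NN := natoms_sqr xs.
have S20 := power_sum2_ge0 xs.
have T0 := truncated_moment_ge0 K xs.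
have ds : delta * s <= s / 2 by nra.
have C0 : 0 <= 4 * (K / s) / s ^+ 2 * power_sum 2 xs.
  by rewrite mulr_ge0// divr_ge0 ?sqr_ge0// mulr_ge0.
have E3 : (3 - 4 * (K / s)) / s ^+ 2 * power_sum 2 xs =
  3 / s ^+ 2 * power_sum 2 xs - 4 * (K / s) / s ^+ 2 * power_sum 2 xs by ring.
set z := k / (s ^+ 2 * (1 - delta) ^+ 2).
have Z2 : 0 <= z ^+ 2 / 2 * (natoms xs ^+ 2 - natoms xs).
  by rewrite mulr_ge0 ?divr_ge0 ?sqr_ge0// subr_ge0.
rewrite /jump; case: (boolP (has _ _)) => hj /=.
  have QK : K < excess xs by exact: excess_jump hj.
  have -> : truncated_moment K xs = natoms xs ^+ 2 + power_sum 2 xs.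
    by rewrite /truncated_moment QK mulr1.
  apply: (@le_trans _ _ 0); last first.
    by have /andP[] := prod_1B_itv w01'; lra.
  rewrite subr_le0 (le_trans _ Z2)// mulr_ge0_le0//.
  have h1 : 2 / s * power_sum 1 xs <= natoms xs + 1 / s ^+ 2 * power_sum 2 xs.
    have := sum_quadratic xs 1 (- (2 / s)) (1 / s ^+ 2).
    suff : 0 <= \sum_(a <- xs) (1 + - (2 / s) * a + 1 / s ^+ 2 * a ^+ 2) by lra.
    apply: sumr_ge0 => a _.
    suff -> : 1 + - (2 / s) * a + 1 / s ^+ 2 * a ^+ 2 = (1 - a / s) ^+ 2.
      exact: sqr_ge0.
    by field; exact: lt0r_neq0.
  have h2 : 2 * natoms xs <= s ^+ 2 + 1 / s ^+ 2 * natoms xs ^+ 2.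
    rewrite -subr_ge0.
    suff -> : s ^+ 2 + 1 / s ^+ 2 * natoms xs ^+ 2 - 2 * natoms xs =
       (s - natoms xs / s) ^+ 2 by exact: sqr_ge0.
    by field; exact: lt0r_neq0.
  have h3 : 0 <= 1 / s ^+ 2 * natoms xs ^+ 2.
    by rewrite mulr_ge0 ?sqr_ge0// divr_ge0// ltW.
  have h4 : 0 <= 1 / s ^+ 2 * power_sum 2 xs.
    by rewrite mulr_ge0// divr_ge0// ltW.
  rewrite E3 mulr1; move: h1 h2 h3 h4 C0.
  have -> : 3 / s ^+ 2 * power_sum 2 xs = 3 * (1 / s ^+ 2 * power_sum 2 xs) by ring.
  have -> : 9 / s ^+ 2 * (natoms xs ^+ 2 + power_sum 2 xs) =
    9 * (1 / s ^+ 2 * natoms xs ^+ 2) + 9 * (1 / s ^+ 2 * power_sum 2 xs) by ring.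
  lra.
have aS a : a \in xs -> a <= delta * s by move=> /(hasPn hj); rewrite -leNgt.
have zle a : a \in xs -> w (r - a) <= z.
  have -> : z = k / s ^+ 2 * (1 - delta) ^- 2.
    by rewrite /z; field; rewrite !lt0r_neq0//; lra.
  move=> /aS h; rewrite wE// inv_sqr_scale// ler_wpM2l//.
  have h' : a / s <= delta by rewrite ler_pdivrMr.
  rewrite lef_pV2 ?posrE ?exprn_gt0//; try lra.
  by rewrite lerXn2r ?nnegrE; lra.
apply: (le_trans _ (bonferroni_ge w01' zle)).
rewrite -/(natoms xs) mulr0 subr0 lerD//; last first.
  by rewrite le_eqVlt; apply/orP; left; apply/eqP; field.
rewrite big_seq; under eq_bigr => a /aS h do rewrite wE//.
rewrite -big_seq.
have aS2 a : a \in xs -> a <= s / 2 by move=> /aS /le_trans; apply.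
have [QK|QK] := ltP K (excess xs); last first.
  have -> : truncated_moment K xs = 0 by rewrite /truncated_moment ltNge QK mulr0.
  rewrite mulr0 subr0; apply: sum_inv_sqr_ge => //.
  by left => a /le_excess h; rewrite ler_pM2r ?invr_gt0// (le_trans h).
have -> : truncated_moment K xs = natoms xs ^+ 2 + power_sum 2 xs.
  by rewrite /truncated_moment QK mulr1.
apply: (le_trans _ (@sum_inv_sqr_ge xs s k 1 s0 k0 ler01 aS2 _)); last by right.
rewrite ler_wpM2l// E3.
have h3 : 0 <= 1 / s ^+ 2 * natoms xs ^+ 2.
  by rewrite mulr_ge0 ?sqr_ge0// divr_ge0// ltW.
have h4 : 0 <= 1 / s ^+ 2 * power_sum 2 xs.
  by rewrite mulr_ge0// divr_ge0// ltW.
have -> : (3 - 4 * 1) / s ^+ 2 * power_sum 2 xs = - (1 / s ^+ 2 * power_sum 2 xs) by ring.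
have -> : 3 / s ^+ 2 * power_sum 2 xs = 3 * (1 / s ^+ 2 * power_sum 2 xs) by ring.
have -> : 9 / s ^+ 2 * (natoms xs ^+ 2 + power_sum 2 xs) =
  9 * (1 / s ^+ 2 * natoms xs ^+ 2) + 9 * (1 / s ^+ 2 * power_sum 2 xs) by ring.
lra.
Qed.

(** In product form the indicator is measurable by [measurable_prod_atoms]. *)
Lemma jumpE s xs :
  jump s xs = 1 - \prod_(a <- xs) (1 - (s < a)%R%:R).
Proof.
rewrite /jump; elim: xs => [|a xs IH] /=; first by rewrite big_nil subrr.
rewrite big_cons; case: ltP => _ /=; first by rewrite subrr mul0r subr0.
by rewrite subr0 mul1r IH.
Qed.

Lemma jump01 s xs : 0 <= jump s xs <= 1.
Proof. by rewrite /jump; case: has => /=; rewrite ?ler01 lexx. Qed.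

End pointwise.

(** * Barriers *)

Section barrier_arithmetic.
Variable R : realFieldType.
Implicit Types (s k K : R).

(** With m = (1 + K/s)^-2 one has y = (k / s^2) m, and the inequality reads, after
    multiplication by s^4 / k, 3 vx - k vn / 2 + errors <= 0.  The gap is g > 0
    and each of the four errors gets a quarter of it. *)
Lemma upper_balance s k K vx vn tau J (g := (k * vn - 6 * vx) / 2)
    (y := k / (s + K) ^+ 2) :
  1 <= s -> 0 < k -> 1 <= K -> 0 <= vn -> 0 <= tau ->
  K * y <= 1 ->
  (16 + k / 2) * tau <= g / 4 ->
  s ^+ 4 * J <= k * g / 4 ->
  64 * K * vx <= g * s ->
  2 * k * vn * K * (k + 4) <= g * s ->
  J + k / s ^+ 2 * (1 + (3 + 16 * (K / s)) / s ^+ 2 * vx + 16 / s ^+ 2 * tau)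
  - (1 - K * y) * y ^+ 2 / 2 * vn + y ^+ 2 / 2 * tau <= k / s ^+ 2.
Proof.
move=> s1 k0 K1 vn0 tau0 Ky htau hJ hx hn.
have s0 : 0 < s by lra.
have s40 : 0 < s ^+ 4 by rewrite exprn_gt0.
pose x := K / s.
have x0 : 0 <= x by rewrite divr_ge0; lra.
have Kx : K = x * s by rewrite /x divfK// lt0r_neq0.
pose m := (1 + x) ^- 2.
have x10 : 0 < (1 + x) ^+ 2 by rewrite exprn_gt0; lra.
have yE : y = k / s ^+ 2 * m.
  by rewrite /y /m Kx; field; rewrite !lt0r_neq0//; nra.
have m0 : 0 < m by rewrite invr_gt0.
have m1 : m <= 1 by rewrite invf_le1//; nra.
have m4 : 1 - 4 * x <= m ^+ 2.
  rewrite /m -exprVn -exprM exprVn -[leRHS]mul1r ler_pdivlMr; last first.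
    by rewrite exprn_gt0; lra.
  have -> : (1 - 4 * x) * (1 + x) ^+ (2 * 2) =
     1 - (10 * x ^+ 2 + 20 * x ^+ 3 + 15 * x ^+ 4 + 4 * x ^+ 5) by ring.
  by rewrite gerBl !addr_ge0// mulr_ge0// exprn_ge0.
have m21 : m ^+ 2 <= 1 by nra.
have yks : K * y <= k * x.
  rewrite yE Kx.
  have -> : x * s * (k / s ^+ 2 * m) = k * x * (m / s) by field; exact: lt0r_neq0.
  rewrite ler_piMr//; first by nra.
  by rewrite ler_pdivrMr//; lra.
have y0 : 0 <= K * y.
  by rewrite yE !mulr_ge0//; try lra; rewrite invr_ge0 exprn_ge0//; lra.
have my : 1 - (k + 4) * x <= (1 - K * y) * m ^+ 2.
  have : 0 <= K * y * (1 - m ^+ 2) by rewrite mulr_ge0//; lra.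
  by lra.
rewrite -subr_ge0.
have -> : k / s ^+ 2 - (J + k / s ^+ 2 * (1 + (3 + 16 * (K / s)) / s ^+ 2 * vx
    + 16 / s ^+ 2 * tau)
  - (1 - K * y) * y ^+ 2 / 2 * vn + y ^+ 2 / 2 * tau)
  = (k * ((1 - K * y) * m ^+ 2 * (k / 2 * vn) - (3 + 16 * x) * vx - 16 * tau
      - m ^+ 2 * (k / 2) * tau) - s ^+ 4 * J) / s ^+ 4.
  by rewrite /x {2 3}yE; field; exact: lt0r_neq0.
rewrite divr_ge0// ?(ltW s40)// subr_ge0 (le_trans hJ)// -mulrA ler_pM2l//.
have e1 : 0 <= ((1 - K * y) * m ^+ 2 - (1 - (k + 4) * x)) * (k / 2 * vn).
  by rewrite mulr_ge0 ?subr_ge0// mulr_ge0//; lra.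
have e2 : 0 <= (1 - m ^+ 2) * (k / 2 * tau).
  by rewrite mulr_ge0 ?subr_ge0// mulr_ge0//; lra.
have e3 : 16 * x * vx <= g / 4.
  rewrite (_ : 16 * x * vx = (64 * K * vx) / s / 4); last first.
    by rewrite /x; field; exact: lt0r_neq0.
  by rewrite ler_pM2r ?invr_gt0// ler_pdivrMr.
have e4 : (k + 4) * x * (k / 2 * vn) <= g / 4.
  rewrite (_ : (k + 4) * x * (k / 2 * vn) = (2 * k * vn * K * (k + 4)) / s / 4); last first.
    by rewrite /x; field; exact: lt0r_neq0.
  by rewrite ler_pM2r ?invr_gt0// ler_pdivrMr.
have -> : (1 - K * y) * m ^+ 2 * (k / 2 * vn) - (3 + 16 * x) * vx - 16 * tau -
  m ^+ 2 * (k / 2) * tau =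
  ((1 - K * y) * m ^+ 2 - (1 - (k + 4) * x)) * (k / 2 * vn)
  + (1 - m ^+ 2) * (k / 2 * tau) + (k / 2 * vn - 3 * vx)
  - (k + 4) * x * (k / 2 * vn) - 16 * x * vx - (16 + k / 2) * tau by ring.
rewrite /g in e3 e4 htau *; lra.
Qed.

(** After multiplication by s^4 / k the inequality reads
    3 vx - k vn / (2 (1 - delta)^4) >= errors, and each of the three errors gets
    a third of the gap g. *)
Lemma lower_balance s k K vx vn tau J (delta : R)
    (g := 3 * vx - k * vn / 2 / (1 - delta) ^+ 4) :
  0 < s -> 0 <= k -> delta < 1 ->
  9 * tau <= g / 3 -> s ^+ 4 * J <= g / 3 -> 12 * K * vx <= g * s ->
  k / s ^+ 2 <= k / s ^+ 2 * (1 + (3 - 4 * (K / s)) / s ^+ 2 * vx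
     - 9 / s ^+ 2 * tau - s ^+ 2 * J)
  - (k / (s ^+ 2 * (1 - delta) ^+ 2)) ^+ 2 / 2 * vn.
Proof.
move=> s0 k0 d1 htau hJ hx.
have s40 : 0 < s ^+ 4 by rewrite exprn_gt0.
rewrite -subr_ge0.
have -> : k / s ^+ 2 * (1 + (3 - 4 * (K / s)) / s ^+ 2 * vx
     - 9 / s ^+ 2 * tau - s ^+ 2 * J)
  - (k / (s ^+ 2 * (1 - delta) ^+ 2)) ^+ 2 / 2 * vn - k / s ^+ 2 =
  k * (g - (12 * K * vx) / s / 3 - 9 * tau - s ^+ 4 * J) / s ^+ 4.
  rewrite /g; field; rewrite !lt0r_neq0//; lra.
rewrite divr_ge0// ?(ltW s40)// mulr_ge0//.
have : (12 * K * vx) / s <= g by rewrite ler_pdivrMr.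
lra.
Qed.

Lemma inv_sqr_le k x y : 0 <= k -> 0 < x -> x <= y -> k / y ^+ 2 <= k / x ^+ 2.
Proof.
move=> k0 x0 xy; have y0 := lt_le_trans x0 xy.
by rewrite ler_wpM2l// lef_pV2 ?posrE ?exprn_gt0// lerXn2r ?nnegrE// ltW.
Qed.

(** The shape k / s^2 of the solutions of the limiting differential equation, frozen
    at its value k / B^2 on the negative half-line so as to be bounded and
    monotone. *)
Definition barrier k (B : R) r := k / (Num.max r 0 + B) ^+ 2.

Section barrier_lemmas.
Variables (k B : R).
Hypotheses (k0 : 0 <= k) (B0 : 0 < B).

Lemma barrier_arg_ge r : B <= Num.max r 0 + B.
Proof. by rewrite lerDr le_max lexx orbT. Qed.

Lemma barrier_nonincreasing x y : x <= y -> barrier k B y <= barrier k B x.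
Proof.
move=> xy; apply: inv_sqr_le => //; first exact: lt_le_trans (barrier_arg_ge x).
by rewrite lerD2r ge_max !le_max xy/= lexx orbT.
Qed.

Lemma barrier_le0 r : barrier k B r <= k / B ^+ 2.
Proof. by apply: inv_sqr_le => //; exact: barrier_arg_ge. Qed.

Lemma barrier_pos r : 0 <= r -> barrier k B r = k / (r + B) ^+ 2.
Proof. by move=> r0; rewrite /barrier max_l. Qed.

Lemma barrier_neg r : r <= 0 -> barrier k B r = k / B ^+ 2.
Proof. by move=> r0; rewrite /barrier max_r// add0r. Qed.

Lemma barrier_le r : 0 < r + B -> barrier k B r <= k / (r + B) ^+ 2.
Proof.
by move=> rB; apply: inv_sqr_le => //; rewrite lerD2r le_max lexx.
Qed.

Lemma barrier_ge r z : r <= z -> 0 <= z -> k / (z + B) ^+ 2 <= barrier k B r.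
Proof.
move=> rz z0; apply: inv_sqr_le => //; first exact: lt_le_trans (barrier_arg_ge r).
by rewrite lerD2r ge_max rz.
Qed.

Lemma barrier01 r : k <= B ^+ 2 -> 0 <= barrier k B r <= 1.
Proof.
move=> kB; rewrite (le_trans (barrier_le0 r)) ?andbT.
  by rewrite divr_ge0// sqr_ge0.
by rewrite ler_pdivrMr ?mul1r// exprn_gt0.
Qed.

End barrier_lemmas.

End barrier_arithmetic.

(** * Analysis of the reproduction equation *)

Section offspring.
Context (R : realType) d (Omega : measurableType d) (P : probability Omega R).
Variables (xs : Omega -> atom_seq R) (var_n var_x : R).
Hypothesis mxs : measurable_fun setT xs.

Let N o := natoms (xs o).
Let S n o := power_sum n (xs o).
Let T K o := truncated_moment K (xs o).
Let J s o := jump s (xs o).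
Let Q o := excess (xs o).

Hypotheses (iN : Rintegrable P N) (EN : expect P N = 1).
Hypotheses (iNN : Rintegrable P (fun o => N o ^+ 2))
           (ENN : expect P (fun o => N o ^+ 2) = var_n + 1).
Hypotheses (iS1 : Rintegrable P (S 1)) (ES1 : expect P (S 1) = 0).
Hypotheses (iS2 : Rintegrable P (S 2)) (ES2 : expect P (S 2) = var_x).
Hypotheses (var_n_gt0 : 0 < var_n) (var_x_gt0 : 0 < var_x).

Lemma measurable_natoms : measurable_fun setT N.
Proof.
by apply: measurable_natr; exact: measurable_size_atoms.
Qed.

Lemma measurable_excess : measurable_fun setT Q.
Proof.
apply: measurable_funD; first exact: measurable_natoms.
by apply: measurable_sum_atoms => //; exact: normr_measurable.
Qed.

Lemma measurable_power_sum n : measurable_fun setT (S n).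
Proof.
by apply: measurable_sum_atoms => //; exact: exprn_measurable.
Qed.

Lemma RintegrableJ s : Rintegrable P (J s).
Proof.
apply: Rintegrable_bounded; last by move=> o; exact: jump01.
rewrite /J; under eq_fun do rewrite jumpE.
apply: measurable_funB => //.
apply: measurable_prod_atoms => //; apply: measurable_funB => //.
by apply: measurable_boolr; exact: measurable_fun_ltr.
Qed.

Lemma RintegrableT K : Rintegrable P (T K).
Proof.
apply: (Rintegrable_le _ _ (RintegrableD iNN iS2)) => [|o]; last first.
  rewrite ger0_norm ?truncated_moment_ge0// /T /truncated_moment.
  case: ltP => _; rewrite ?mulr1 ?mulr0//.
  by rewrite addr_ge0 ?sqr_ge0// power_sum2_ge0.
apply: measurable_funM.
  apply: measurable_funD; last exact: measurable_power_sum.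
  by apply: measurable_funX; exact: measurable_natoms.
by apply: measurable_boolr; apply: measurable_fun_ltr => //; exact: measurable_excess.
Qed.

Lemma expect_truncated_moment (e : R) : 0 < e ->
  exists2 K : R, 1 <= K & expect P (T K) <= e.
Proof.
move=> e0; apply: (expect_truncation e0 (RintegrableD iNN iS2)).
  by move=> o; rewrite addr_ge0 ?sqr_ge0// power_sum2_ge0.
exact: measurable_excess.
Qed.

Let G o : R := (2 <= size (xs o))%N%:R.
Let p := expect P G.

Lemma RintegrableG : Rintegrable P G.
Proof.
apply: Rintegrable_bounded; last first.
  by move=> o; rewrite /G; case: leqP => /=; rewrite ?ler01 lexx.
apply: measurable_boolr.
have m2 : measurable_fun setT (fun n : nat => (2 <= n)%N) by [].
exact: (measurableT_comp m2 (measurable_size_atoms mxs)).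
Qed.

(** If p were 0 then N^2 = N almost surely, whereas E (N^2 - N) = var_n > 0.  The
    truncated moment makes this quantitative: var_n <= K^2 p + var_n / 2. *)
Lemma branching_prob_gt0 : 0 < p.
Proof.
have e0 : 0 < var_n / 2 by rewrite divr_gt0.
have [K K1 KT] := expect_truncated_moment e0.
have : expect P (fun o => N o ^+ 2 - N o) <=
       expect P (fun o => K ^+ 2 * G o + T K o).
  apply: le_expect; first exact: RintegrableB.
    by apply: RintegrableD; [apply: RintegrableZ; exact: RintegrableG|exact: RintegrableT].
  move=> o; rewrite /T /truncated_moment /G.
  have S20 := power_sum2_ge0 (xs o).
  have [QK|QK] := ltP K (excess (xs o)).
    have : 0 <= K ^+ 2 * (2 <= size (xs o))%N%:R by rewrite mulr_ge0// sqr_ge0.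
    have : 0 <= N o by [].
    rewrite mulr1 -/(N o); lra.
  rewrite mulr0 addr0.
  have NK : N o <= K := le_trans (natoms_le_excess _) QK.
  have N0 : 0 <= N o by [].
  have [n2|] := leqP 2 (size (xs o)); first by rewrite mulr1n mulr1; nra.
  rewrite /N /natoms; case: (size _) => [|[|//]] _; rewrite mulr0.
    by rewrite expr0n subrr.
  by rewrite expr1n subrr.
rewrite expectB// expectD; last 2 first.
- by apply: RintegrableZ; exact: RintegrableG.
- exact: RintegrableT.
rewrite expectZ; last exact: RintegrableG.
rewrite EN ENN -/p => h.
have : 0 < K ^+ 2 * p by lra.
by rewrite pmulr_rgt0// exprn_gt0; lra.
Qed.

(** Monotonicity makes a profile Borel, so that [reproduce] is a genuine
    expectation. *)
Definition profile (w : R -> R) :=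
  (forall x y, x <= y -> w y <= w x) /\ (forall x, 0 <= w x <= 1).

Definition reproduce (w : R -> R) r :=
  expect P (fun o => 1 - \prod_(a <- (xs o : seq R)) (1 - w (r - a))).

Lemma Rintegrable_reproduce w r : profile w ->
  Rintegrable P (fun o => 1 - \prod_(a <- (xs o : seq R)) (1 - w (r - a))).
Proof.
move=> [wni w01]; apply: Rintegrable_bounded.
  apply: measurable_funB => //.
  apply: measurable_prod_atoms => //; apply: nonincreasing_measurable => //.
  by move=> x y xy; rewrite lerD2l lerN2 wni// lerD2l lerN2.
move=> o; have w01' : {in xs o, forall a, 0 <= w (r - a) <= 1} by [].
have /andP[] := prod_1B_itv w01'.
by move=> ? ?; apply/andP; split; lra.
Qed.

(** Since E N = 1, the linear term of [exprB1_le_ge2] has mean D: the extinction map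
    D |-> E (1 - (1 - D)^N) lies strictly below the identity for D > 0. *)
Lemma expect_extinction_le (D : R) : 0 <= D <= 1 ->
  Rintegrable P (fun o => 1 - (1 - D) ^+ size (xs o)) /\
  expect P (fun o => 1 - (1 - D) ^+ size (xs o)) <= D - p * D ^+ 2.
Proof.
move=> D01; have /andP[D0 D1] := D01.
have i : Rintegrable P (fun o => 1 - (1 - D) ^+ size (xs o)).
  have h : profile (fun=> D) by split.
  have := Rintegrable_reproduce 0 h.
  by under eq_fun do rewrite big_const_seq count_predT iter_mulr_1.
split => //.
have -> : D - p * D ^+ 2 = expect P (fun o => D * N o - D ^+ 2 * G o).
  rewrite expectB; try by apply: RintegrableZ; rewrite ?RintegrableG.
  by rewrite !expectZ ?RintegrableG// EN mulr1 mulrC.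
apply: le_expect => //.
  by apply: RintegrableB; apply: RintegrableZ => //; exact: RintegrableG.
by move=> o; rewrite mulrC (mulrC _ (G o)); exact: exprB1_le_ge2.
Qed.

(** Let D be the supremum of u1 - u2.  If D > 0, the smaller number D - p D^2 is an
    upper bound as well: below r0 because it is nonnegative, and from r0 on because
    u1 - u2 <= reproduce u1 - reproduce u2 <= E (1 - (1 - D)^N) by
    [prod_diff_le]. *)
Lemma comparison (u1 u2 : R -> R) r0 : profile u1 -> profile u2 ->
  (forall r, r < r0 -> u1 r <= u2 r) ->
  (forall r, r0 <= r -> u1 r <= reproduce u1 r) ->
  (forall r, r0 <= r -> reproduce u2 r <= u2 r) ->
  forall r, u1 r <= u2 r.
Proof.
move=> p1 p2 lt0 sub1 sup2 r.
have [ni1 b1] := p1; have [ni2 b2] := p2.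
pose A := [set u1 t - u2 t | t in [set: R]].
have hA : has_sup A.
  split; first by exists (u1 r - u2 r), r.
  exists 1 => _ [t _ <-]; have /andP[? ?] := b1 t; have /andP[? ?] := b2 t; lra.
have ubA t : u1 t - u2 t <= sup A.
  by apply: ub_le_sup; [case: hA|exists t].
have [A0|A0] := leP (sup A) 0.
  by rewrite -subr_le0 (le_trans (ubA r)).
have A1 : sup A <= 1.
  apply: ge_sup; first by case: hA.
  by move=> _ [t _ <-]; have /andP[? ?] := b1 t; have /andP[? ?] := b2 t; lra.
have A01 : 0 <= sup A <= 1 by rewrite ltW.
have [iE leE] := expect_extinction_le A01.
have p0 := branching_prob_gt0.
suff : sup A <= sup A - p * sup A ^+ 2.
  have : 0 < p * sup A ^+ 2 by rewrite mulr_gt0// exprn_gt0.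
  lra.
apply: ge_sup; first by case: hA.
have pos : 0 <= sup A - p * sup A ^+ 2.
  by rewrite (le_trans _ leE)// expect_ge0// => o; rewrite subr_ge0 exprn_ile1; lra.
move=> _ [t _ <-].
have [tr0|tr0] := ltP t r0; first by have := lt0 t tr0; lra.
rewrite (le_trans (lerB (sub1 t tr0) (sup2 t tr0)))// (le_trans _ leE)//.
rewrite /reproduce -expectB; try exact: Rintegrable_reproduce.
apply: le_expect => //.
  by apply: RintegrableB; exact: Rintegrable_reproduce.
move=> o.
have := @prod_diff_le _ _ (fun a => 1 - u2 (t - a)) (fun a => 1 - u1 (t - a))
  (xs o) (sup A) A01.
have c (u : R -> R) : (forall x, 0 <= u x <= 1) ->
    {in xs o, forall a, 0 <= 1 - u (t - a) <= 1}.
  by move=> b a _; have /andP[? ?] := b (t - a); apply/andP; split; lra.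
move=> /(_ (c _ b2) (c _ b1)).
have c' : {in xs o, forall a, 1 - u2 (t - a) - (1 - u1 (t - a)) <= sup A}.
  by move=> a _; have := ubA (t - a); lra.
by move=> /(_ c'); lra.
Qed.

Hypothesis tailJ : forall e, 0 < e -> exists s0, forall s, s0 <= s ->
  s ^+ 4 * expect P (J s) <= e.

Variable v : R -> R.
Hypotheses (pv : profile v) (v_lt0 : forall r, r < 0 -> v r = 1).
Hypothesis v_fix : forall r, 0 <= r -> reproduce v r = v r.

Lemma jump_prob_ge0 s : 0 <= expect P (J s).
Proof. by apply: expect_ge0 => o; have /andP[] := jump01 s (xs o). Qed.

(** Let l be the infimum of v and v r0 be close to l.  If no atom exceeds s, all
    values of v entering the equation at r0 + s are at most v r0; hence
    l <= v (r0 + s) <= P(jump) + v r0 - p (v r0)^2 for all s, so l = 0. *)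
Lemma profile_vanishes (e : R) : 0 < e -> exists2 r, 0 <= r & v r <= e.
Proof.
move=> e0; apply: contrapT => /forall2NP h.
have {}h r : 0 <= r -> e < v r.
  by move=> r0; case: (h r) => // /negP; rewrite -ltNge.
have [ni b] := pv.
pose A := [set v r | r in [set r | 0 <= r]].
have hA : has_inf A.
  split; first by exists (v 0), 0 => /=.
  by exists 0 => _ [t _ <-]; have /andP[] := b t.
have lA t : 0 <= t -> inf A <= v t.
  by move=> t0; apply: ge_inf; [case: hA|exists t].
have eA : e <= inf A.
  by apply: lb_le_inf; [case: hA|move=> _ [t t0 <-]; rewrite ltW// h].
have p0 := branching_prob_gt0.
have l0 : 0 < inf A by lra.
set l := inf A in lA l0 eA *.
have q0 : 0 < p * l ^+ 2 / 4 by rewrite divr_gt0// mulr_gt0// exprn_gt0.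
have [_ [r0 r00 <-] rl] := inf_adherent q0 hA; rewrite -/l in rl.
have [s0 hs0] := tailJ q0.
pose s := Num.max 1 s0.
have s1 : 1 <= s by rewrite /s le_max lexx.
have hs : s ^+ 4 * expect P (J s) <= p * l ^+ 2 / 4.
  by apply: hs0; rewrite /s le_max lexx orbT.
have J0 := jump_prob_ge0 s.
have {}hs : expect P (J s) <= p * l ^+ 2 / 4.
  by rewrite (le_trans _ hs)// ler_peMl// exprn_ege1.
have /= r00' := r00.
have rs0 : 0 <= r0 + s by lra.
have [iE leE] := expect_extinction_le (b r0).
have : v (r0 + s) <= expect P (J s) + (v r0 - p * v r0 ^+ 2).
  rewrite -v_fix// (le_trans _ (lerD (lexx _) leE))// -expectD//; last first.
    exact: RintegrableJ.
  apply: le_expect; first exact: Rintegrable_reproduce.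
    by apply: RintegrableD => //; exact: RintegrableJ.
  move=> o; rewrite /J /jump.
  have b' : {in xs o, forall a, 0 <= v (r0 + s - a) <= 1} by [].
  have /andP[x0 x1] := prod_1B_itv b'.
  have /andP[y0 y1] := b r0.
  have z1 : (1 - v r0) ^+ size (xs o) <= 1 by rewrite exprn_ile1; lra.
  case: (boolP (has _ _)) => hj /=; first by lra.
  suff : (1 - v r0) ^+ size (xs o) <=
         \prod_(a <- (xs o : seq R)) (1 - v (r0 + s - a)) by lra.
  rewrite -iter_mulr_1 -(count_predT (xs o : seq R)) -big_const_seq.
  rewrite big_seq [leRHS]big_seq; apply: ler_prod => a axs.
  rewrite subr_ge0 y1 /= lerD2l lerN2 ni//.
  by have := hasPn hj _ axs; rewrite -leNgt; lra.
have := lA _ rs0.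
have : p * l ^+ 2 <= p * v r0 ^+ 2.
  rewrite ler_wpM2l// ?(ltW p0)// lerXn2r ?nnegrE ?(ltW l0)//; last exact: lA.
  by have /andP[] := b r0.
lra.
Qed.

Lemma reproduce_upper w r s k K (y := k / (s + K) ^+ 2) : profile w ->
  0 <= k -> 1 <= K -> 2 * K <= s -> K * y <= 1 ->
  (forall a, a <= s / 2 -> w (r - a) <= k / (s - a) ^+ 2) ->
  (forall a, `|a| <= K -> y <= w (r - a)) ->
  reproduce w r <= expect P (J (s / 2)) + k / s ^+ 2 * (1
     + (3 + 16 * (K / s)) / s ^+ 2 * var_x + 16 / s ^+ 2 * expect P (T K))
  - (1 - K * y) * y ^+ 2 / 2 * var_n + y ^+ 2 / 2 * expect P (T K).
Proof.
move=> pw k0 K1 Ks Ky wle wge; have [_ w01] := pw.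
have iT := RintegrableT K; have iJ := RintegrableJ (s / 2).
pose f1 o := N o + 2 / s * S 1 o.
have i1 : Rintegrable P f1 by apply: RintegrableD => //; exact: RintegrableZ.
have E1 : expect P f1 = 1.
  by rewrite expectD ?expectZ ?EN ?ES1 ?mulr0 ?addr0//; exact: RintegrableZ.
pose f2 o := f1 o + (3 + 16 * (K / s)) / s ^+ 2 * S 2 o.
have i2 : Rintegrable P f2 by apply: RintegrableD => //; exact: RintegrableZ.
have E2 : expect P f2 = 1 + (3 + 16 * (K / s)) / s ^+ 2 * var_x.
  by rewrite expectD ?expectZ ?E1 ?ES2//; exact: RintegrableZ.
pose f3 o := f2 o + 16 / s ^+ 2 * T K o.
have i3 : Rintegrable P f3 by apply: RintegrableD => //; exact: RintegrableZ.
have E3 : expect P f3 =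
    1 + (3 + 16 * (K / s)) / s ^+ 2 * var_x + 16 / s ^+ 2 * expect P (T K).
  by rewrite expectD ?expectZ ?E2//; exact: RintegrableZ.
pose f4 o := J (s / 2) o + k / s ^+ 2 * f3 o.
have i4 : Rintegrable P f4 by apply: RintegrableD => //; exact: RintegrableZ.
have E4 : expect P f4 = expect P (J (s / 2)) + k / s ^+ 2 * expect P f3.
  by rewrite expectD ?expectZ//; exact: RintegrableZ.
pose g o := N o ^+ 2 - N o.
have ig : Rintegrable P g by exact: RintegrableB.
have Eg : expect P g = var_n by rewrite expectB// ENN EN; ring.
pose f5 o := f4 o - (1 - K * y) * y ^+ 2 / 2 * g o.
have i5 : Rintegrable P f5 by apply: RintegrableB => //; exact: RintegrableZ.
have E5 : expect P f5 = expect P f4 - (1 - K * y) * y ^+ 2 / 2 * var_n.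
  by rewrite expectB ?expectZ ?Eg//; exact: RintegrableZ.
rewrite -E3 -E4 -E5 -expectZ// -expectD//; last exact: RintegrableZ.
apply: le_expect; first exact: Rintegrable_reproduce.
  by apply: RintegrableD => //; exact: RintegrableZ.
by move=> o; exact: upper_pointwise.
Qed.

Lemma reproduce_lower w r s k K (delta : R) : profile w ->
  0 <= k -> 1 <= K -> 0 < delta -> delta <= 2^-1 -> K <= delta * s ->
  (forall a, a <= delta * s -> w (r - a) = k / (s - a) ^+ 2) ->
  k / s ^+ 2 * (1 + (3 - 4 * (K / s)) / s ^+ 2 * var_x
     - 9 / s ^+ 2 * expect P (T K) - s ^+ 2 * expect P (J (delta * s)))
  - (k / (s ^+ 2 * (1 - delta) ^+ 2)) ^+ 2 / 2 * var_n
  <= reproduce w r.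
Proof.
move=> pw k0 K1 d0 d2 Ks wE; have [_ w01] := pw.
have iT := RintegrableT K; have iJ := RintegrableJ (delta * s).
pose f1 o := N o + 2 / s * S 1 o.
have i1 : Rintegrable P f1 by apply: RintegrableD => //; exact: RintegrableZ.
have E1 : expect P f1 = 1.
  by rewrite expectD ?expectZ ?EN ?ES1 ?mulr0 ?addr0//; exact: RintegrableZ.
pose f2 o := f1 o + (3 - 4 * (K / s)) / s ^+ 2 * S 2 o.
have i2 : Rintegrable P f2 by apply: RintegrableD => //; exact: RintegrableZ.
have E2 : expect P f2 = 1 + (3 - 4 * (K / s)) / s ^+ 2 * var_x.
  by rewrite expectD ?expectZ ?E1 ?ES2//; exact: RintegrableZ.
pose f3 o := f2 o - 9 / s ^+ 2 * T K o.
have i3 : Rintegrable P f3 by apply: RintegrableB => //; exact: RintegrableZ.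
have E3 : expect P f3 =
    1 + (3 - 4 * (K / s)) / s ^+ 2 * var_x - 9 / s ^+ 2 * expect P (T K).
  by rewrite expectB ?expectZ ?E2//; exact: RintegrableZ.
pose f4 o := f3 o - s ^+ 2 * J (delta * s) o.
have i4 : Rintegrable P f4 by apply: RintegrableB => //; exact: RintegrableZ.
have E4 : expect P f4 = expect P f3 - s ^+ 2 * expect P (J (delta * s)).
  by rewrite expectB ?expectZ//; exact: RintegrableZ.
pose g o := N o ^+ 2 - N o.
have ig : Rintegrable P g by exact: RintegrableB.
have Eg : expect P g = var_n by rewrite expectB// ENN EN; ring.
rewrite -E3 -E4 -expectZ// -Eg -expectZ// -expectB//; try exact: RintegrableZ.
apply: le_expect; last by move=> o; exact: lower_pointwise.
  by apply: RintegrableB; exact: RintegrableZ.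
exact: Rintegrable_reproduce.
Qed.


(** The barrier is 1 below R1, then k / B^2 up to r1 = R1 + B / 2 and k / s^2
    beyond, with s = r - r1 + B.  It dominates v below r1 once v R1 <= k / B^2;
    beyond r1, an atom of size at most s / 2 leads to a level above R1, where the
    barrier is small. *)
Lemma upper_envelope k : 0 < k -> 6 * var_x < k * var_n ->
  exists b r1 : R, forall r, r1 <= r -> b < r /\ v r <= k / (r - b) ^+ 2.
Proof.
move=> k0 kc; have [v_ni v01] := pv.
have vx0 := ltW var_x_gt0; have vn0 := ltW var_n_gt0.
pose g := (k * var_n - 6 * var_x) / 2.
have g0 : 0 < g by rewrite divr_gt0// subr_gt0.
have k16 : 0 < 16 + k / 2 by lra.
have [K K1 KT] := @expect_truncated_moment (g / 4 / (16 + k / 2))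
  ltac:(by rewrite divr_gt0// divr_gt0).
have [s0 hs0] := @tailJ (k * g / 64) ltac:(by rewrite divr_gt0// mulr_gt0).
set c1 := 64 * K * var_x / g; set c2 := 2 * k * var_n * K * (k + 4) / g.
have c10 : 0 <= c1 by rewrite divr_ge0 ?(ltW g0)// !mulr_ge0//; lra.
have c20 : 0 <= c2 by rewrite divr_ge0 ?(ltW g0)// !mulr_ge0//; lra.
have Kk0 : 0 <= K * k by rewrite mulr_ge0; lra.
(* each summand of B meets one of the requirements on s >= B *)
pose B := 1 + 2 * `|s0| + 2 * K + k + K * k + c1 + c2.
have s0n := normr_ge0 s0; have s0le := ler_norm s0.
have [B1 BK Bs Bk [BKk Bc1 Bc2]] : [/\ 1 <= B, 2 * K <= B, 2 * `|s0| <= B,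
    k <= B & [/\ K * k <= B, c1 <= B & c2 <= B]] by do ?split; rewrite /B; lra.
clearbody B.
have B_gt0 : 0 < B by exact: lt_le_trans ltr01 B1.
have k0' := ltW k0.
have kBB : k <= B ^+ 2 by rewrite (le_trans Bk)// expr2 ler_peMl// ltW.
have kB0 : 0 < k / B ^+ 2 by rewrite divr_gt0// exprn_gt0.
have [R1 R10 vR1] := profile_vanishes kB0.
pose r1 := R1 + B / 2.
have r1E : r1 = R1 + B / 2 by [].
pose w r := if r < R1 then 1 else barrier k B (r - r1).
have w_ge r : R1 <= r -> w r = barrier k B (r - r1) by rewrite /w; case: ltP.
have pw : profile w.
  split=> [x y xy|x]; rewrite /w.
    case: (ltP y R1) => yR1; first by rewrite (le_lt_trans xy).
    case: (ltP x R1) => xR1; first by have /andP[] := barrier01 k0' B_gt0 (y - r1) kBB.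
    by apply: barrier_nonincreasing => //; rewrite lerD2r.
  by case: ifP => _; [rewrite ler01 lexx|exact: barrier01].
clearbody r1.
have Rr1 : R1 <= r1 by lra.
have w_far r : r1 <= r -> w r = k / (r - r1 + B) ^+ 2.
  by move=> rr1; rewrite w_ge ?(le_trans Rr1)// barrier_pos// subr_ge0.
exists (r1 - B), r1 => r rr1; split.
  by rewrite ltrBlDr (le_lt_trans rr1)// ltrDl.
have -> : r - (r1 - B) = r - r1 + B by ring.
rewrite -w_far//.
apply: (@comparison v w r1) => //.
- move=> t tr1; have [tR1|tR1] := ltP t R1.
    by rewrite /w tR1; have /andP[] := v01 t.
  rewrite w_ge// barrier_neg; last by rewrite subr_le0 ltW.
  by rewrite (le_trans _ vR1)// v_ni.
- by move=> t tr1; rewrite v_fix// (le_trans _ tr1)// (le_trans R10).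
move=> t tr1; pose s := t - r1 + B.
have sE : s = t - r1 + B by [].
have sB : B <= s by rewrite lerDr subr_ge0.
have w_mid a : a <= s / 2 -> R1 <= t - a by move=> a2; lra.
have sK1 : 2 * K <= s by lra.
have ss0 : s0 <= s / 2 by lra.
have s1 : 1 <= s by lra.
have s_gt0 : 0 < s by exact: lt_le_trans ltr01 s1.
have KB : K * (k / (s + K) ^+ 2) <= 1.
  have K0 : 0 < K := lt_le_trans ltr01 K1.
  have sK0 : 0 < s + K := addr_gt0 s_gt0 K0.
  rewrite mulrA ler_pdivrMr ?mul1r ?exprn_gt0//.
  rewrite (le_trans BKk)// (le_trans sB)// (@le_trans _ _ (s + K))//.
    by rewrite lerDl ltW.
  by rewrite expr2; apply: ler_peMl; lra.
rewrite w_far//; apply: le_trans (reproduce_upper pw k0' K1 sK1 KB _ _) _.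
- move=> a a2; rewrite w_ge ?w_mid//.
  have -> : s - a = t - a - r1 + B by rewrite sE; ring.
  by apply: barrier_le => //; lra.
- move=> a aK; have aKK : a <= K := le_trans (ler_norm a) aK.
  have aKN : - a <= K by rewrite (le_trans (ler_norm _))// normrN.
  rewrite w_ge; last by apply: w_mid; lra.
  have -> : s + K = (t - r1 + K) + B by rewrite sE; ring.
  by apply: barrier_ge => //; lra.
apply: upper_balance => //.
- by apply: expect_ge0 => o; exact: truncated_moment_ge0.
- by rewrite -/g mulrC -ler_pdivlMr.
- have := hs0 (s / 2) ltac:(lra).
  rewrite -/g expr_div_n (_ : 2 ^+ 4 = 16 :> R); last by ring.
  lra.
- by rewrite -/g -ler_pdivrMl// mulrC (le_trans _ sB).
- by rewrite -/g -ler_pdivrMl// mulrC (le_trans _ sB).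
Qed.

(** The barrier k / (r + 2 C)^2, frozen below - C, is at most 1 everywhere, hence
    below v on the negative half-line.  The factor (1 - delta)^4, which comes from
    atoms of size up to delta * s, must not spoil k * var_n < 6 * var_x. *)
Lemma lower_envelope k : 0 < k -> k * var_n < 6 * var_x ->
  exists b : R, forall r, 0 <= r -> 0 < r + b /\ k / (r + b) ^+ 2 <= v r.
Proof.
move=> k0 kc; have [v_ni v01] := pv.
have vx0 := ltW var_x_gt0; have vn0 := ltW var_n_gt0.
pose rho := k * var_n / (6 * var_x).
have rho0 : 0 < rho by rewrite divr_gt0 ?mulr_gt0.
have rho1 : rho < 1 by rewrite ltr_pdivrMr ?mul1r ?mulr_gt0.
(* so that (1 - delta)^4 >= 1 - 4 delta = (1 + rho) / 2 > rho *)
pose delta := (1 - rho) / 8.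
have dE : delta = (1 - rho) / 8 by [].
have d0 : 0 < delta by lra.
have d4 : rho < (1 - delta) ^+ 4.
  have /andP[] := @exprB1_le _ delta 4 ltac:(apply/andP; split; lra).
  by lra.
have d40 : 0 < (1 - delta) ^+ 4 by rewrite exprn_gt0; lra.
pose g := 3 * var_x - k * var_n / 2 / (1 - delta) ^+ 4.
have g0 : 0 < g.
  have : k * var_n < 6 * var_x * (1 - delta) ^+ 4.
    by rewrite -ltr_pdivrMl ?mulr_gt0// mulrC.
  by rewrite /g subr_gt0 ltr_pdivrMr// ltr_pdivrMr//; lra.
have [K K1 KT] := @expect_truncated_moment (g / 27) ltac:(by rewrite divr_gt0).
have [s0 hs0] := @tailJ (delta ^+ 4 * g / 3)
  ltac:(by rewrite divr_gt0// mulr_gt0// exprn_gt0).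
pose c1 := 12 * K * var_x / g; pose c2 := K / delta; pose c3 := `|s0| / delta.
have c10 : 0 <= c1 by rewrite divr_ge0 ?(ltW g0)// !mulr_ge0//; lra.
have c20 : 0 <= c2 by rewrite divr_ge0; lra.
have c30 : 0 <= c3 by rewrite divr_ge0//; lra.
pose C := 1 + k + c1 + c2 + c3.
have [C1 Ck Cc1 Cc2 Cc3] : [/\ 1 <= C, k <= C, c1 <= C, c2 <= C & c3 <= C].
  by split; rewrite /C; lra.
clearbody C.
have C0 : 0 < C by exact: lt_le_trans ltr01 C1.
have k0' := ltW k0.
have kCC : k <= C ^+ 2 by rewrite (le_trans Ck)// expr2 ler_peMl// ltW.
pose w r := barrier k C (r + C).
have pw : profile w.
  split=> [x y xy|x]; last exact: barrier01.
  by apply: barrier_nonincreasing => //; rewrite lerD2r.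
have wE r : - C <= r -> w r = k / (r + (C + C)) ^+ 2.
  by move=> rC; rewrite /w barrier_pos ?addrA// -lerBlDr sub0r.
exists (C + C) => r r0; split; first by rewrite ltr_wpDl// addr_gt0.
rewrite -wE ?(le_trans _ r0) ?oppr_le0 ?(ltW C0)//.
apply: (@comparison w v 0) => //.
- by move=> t t0; rewrite v_lt0//; have /andP[] := barrier01 k0' C0 (t + C) kCC.
- move=> t t0; pose s := t + (C + C).
  have sC : C <= s by rewrite /s addrA lerDr addr_ge0 ?(ltW C0).
  have s2C : C <= s / 2 by rewrite /s; lra.
  have s_gt0 : 0 < s := lt_le_trans C0 sC.
  have d2 : delta <= 2^-1 by rewrite dE; lra.
  have ds : delta * s <= s / 2 by rewrite mulrC ler_pM2l.
  have Ks : K <= delta * s by rewrite -ler_pdivrMl// mulrC (le_trans _ sC).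
  have s0s : s0 <= delta * s.
    by rewrite (le_trans (ler_norm _))// -ler_pdivrMl// mulrC (le_trans _ sC).
  rewrite wE; last by rewrite (le_trans _ t0)// oppr_le0 ltW.
  rewrite -/s; apply: le_trans _ (reproduce_lower pw k0' K1 d0 d2 Ks _).
  + apply: lower_balance => //.
    * by rewrite (le_lt_trans d2)// invf_lt1// ltr1n.
    * by rewrite -/g; lra.
    * rewrite -/g -(ler_pM2l (exprn_gt0 4 d0)) mulrA -exprMn [leRHS]mulrA.
      exact: hs0.
    * by rewrite -/g -ler_pdivrMl// mulrC (le_trans _ sC).
  + move=> a a2; rewrite wE; last by rewrite /s in ds a2 *; lra.
    by congr (_ / _ ^+ _); rewrite /s; ring.
- by move=> t t0; rewrite v_fix.
Qed.

End offspring.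

(** * From envelopes to an equivalent *)

Section squeeze.
Variable R : realType.

Lemma shift_sqr_upper (b e r : R) : 0 <= e -> 0 < r -> 4 * (1 + e) * `|b| <= e * r ->
  (1 + e / 2) * r ^+ 2 <= (1 + e) * (r - b) ^+ 2.
Proof.
move=> e0 r0 h; have /ler_normlP [bl br] := lexx `|b|.
have : 0 <= (r - b) ^+ 2 - r * (r - 2 * `|b|).
  have : 0 <= r * (`|b| - b) by rewrite mulr_ge0//; lra.
  by have := sqr_ge0 b; lra.
move: ((r - b) ^+ 2) => z hz.
have : 0 <= (1 + e) * (z - r * (r - 2 * `|b|)) by rewrite mulr_ge0//; lra.
have : 0 <= r * (e * r - 4 * (1 + e) * `|b|) by rewrite mulr_ge0//; lra.
lra.
Qed.

Lemma shift_sqr_lower (b e r : R) : 0 <= e -> 0 < r -> e <= 1 ->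
  `|b| <= r -> 6 * `|b| <= e * r ->
  (1 - e) * (r + b) ^+ 2 <= (1 - e / 2) * r ^+ 2.
Proof.
move=> e0 r0 e1 br h; have /ler_normlP [bl br'] := lexx `|b|.
have : (r + b) ^+ 2 <= r * (r + 3 * `|b|).
  have : 0 <= r * (`|b| - b) by rewrite mulr_ge0//; lra.
  have : 0 <= `|b| * (r - `|b|) by rewrite mulr_ge0//; lra.
  by have := real_normK (num_real b); lra.
move: ((r + b) ^+ 2) => z hz.
have : 0 <= (1 - e) * (r * (r + 3 * `|b|) - z) by rewrite mulr_ge0//; lra.
have : 0 <= r * (e * r - 6 * `|b|) by rewrite mulr_ge0//; lra.
have : 0 <= e * (r * `|b|) by rewrite !mulr_ge0//; lra.
lra.
Qed.

(** For a relative error e, the envelopes of constants c (1 + e/2) and c (1 - e/2)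
    are used; the other half of e pays for the shifts b. *)
Lemma equiv_inv_sqr (v : R -> R) (c : R) : 0 < c ->
  (forall k, c < k -> exists b r1 : R, forall r, r1 <= r ->
     b < r /\ v r <= k / (r - b) ^+ 2) ->
  (forall k, 0 < k -> k < c -> exists b : R, forall r, 0 <= r ->
     0 < r + b /\ k / (r + b) ^+ 2 <= v r) ->
  (v : R -> R^o) ~_(pinfty_nbhs R) (fun r => c / r ^+ 2 : R^o).
Proof.
move=> c0 up lo; apply/eqaddoP => e e0.
(* e' <= 1 keeps c (1 - e' / 2) positive *)
pose e' := Num.min e 1.
have e'0 : 0 < e' by rewrite lt_min e0 ltr01.
have e'e : e' <= e by rewrite ge_min lexx.
have e'1 : e' <= 1 by rewrite ge_min lexx orbT.
clearbody e'.
have [|b1 [r1 h1]] := up (c * (1 + e' / 2)); first by rewrite ltr_pMr//; lra.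
have [||b2 h2] := lo (c * (1 - e' / 2)).
  by rewrite mulr_gt0//; lra.
  by rewrite gtr_pMr//; lra.
near=> r.
have r0 : 0 < r by near: r; exact: nbhs_pinfty_gt (num_real _).
have r2 : 0 < r ^+ 2 by rewrite exprn_gt0.
have [b1r v_le] : b1 < r /\ v r <= c * (1 + e' / 2) / (r - b1) ^+ 2.
  by apply: h1; near: r; exact: nbhs_pinfty_ge (num_real _).
have [b2r v_ge] := h2 r (ltW r0).
have rb1 : 4 * (1 + e') * `|b1| <= e' * r.
  by rewrite -ler_pdivrMl//; near: r; exact: nbhs_pinfty_ge (num_real _).
have rb2 : `|b2| <= r by near: r; exact: nbhs_pinfty_ge (num_real _).
have rb3 : 6 * `|b2| <= e' * r.
  by rewrite -ler_pdivrMl//; near: r; exact: nbhs_pinfty_ge (num_real _).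
have c2 : 0 < c / r ^+ 2 by rewrite divr_gt0.
rewrite [Num.norm (c / r ^+ 2)]gtr0_norm//.
apply: (@le_trans _ _ (e' * (c / r ^+ 2))); last by rewrite ler_pM2r.
have up_r : c * (1 + e' / 2) / (r - b1) ^+ 2 <= (1 + e') * (c / r ^+ 2).
  rewrite ler_pdivrMr ?exprn_gt0 ?subr_gt0//.
  have -> : (1 + e') * (c / r ^+ 2) * (r - b1) ^+ 2 =
    c * ((1 + e') * (r - b1) ^+ 2) / r ^+ 2 by field; exact: lt0r_neq0.
  rewrite ler_pdivlMr// -mulrA ler_pM2l//; exact: shift_sqr_upper (ltW e'0) r0 rb1.
have lo_r : (1 - e') * (c / r ^+ 2) <= c * (1 - e' / 2) / (r + b2) ^+ 2.
  rewrite ler_pdivlMr ?exprn_gt0//.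
  have -> : (1 - e') * (c / r ^+ 2) * (r + b2) ^+ 2 =
    c * ((1 - e') * (r + b2) ^+ 2) / r ^+ 2 by field; exact: lt0r_neq0.
  rewrite ler_pdivrMr// -mulrA ler_pM2l//; 
  exact: shift_sqr_lower (ltW e'0) r0 e'1 rb2 rb3.
have -> : (v - (fun r => c / r ^+ 2)) r = v r - c / r ^+ 2 by [].
by rewrite ler_norml; apply/andP; split; lra.
Unshelve. all: by end_near.
Qed.

End squeeze.

(** * Independent families of labels *)

Section image_measure.
Context d1 d2 (T1 : measurableType d1) (T2 : measurableType d2) (R : realType).

(** The structure of measure on [pushforward m f] depends on the proof that f is
    measurable, which unification does not find; here it is an argument. *)
Definition image_measure (m : {measure set T1 -> \bar R}) (f : T1 -> T2)
    (mf : measurable_fun setT f) : {measure set T2 -> \bar R} :=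
  measure_function_pushforward__canonical__measure_function_Measure m mf.

End image_measure.

Section families.
Context dM (M : measurableType dM).

(** Cylinders generate the product sigma-algebra on families of labels, and form a
    pi-system: identities between measures are checked on them. *)
Definition cylinder (I : eqType) (s : seq I) (A : I -> set M) : set (I -> M) :=
  [set x | forall i, i \in s -> A i (x i)].

Definition cylinders (I : eqType) : set (set (I -> M)) :=
  [set C | exists s A, (forall i, measurable (A i)) /\ C = cylinder s A].

Definition families (I : eqType) := g_sigma_algebraType (@cylinders I).

Lemma cylinders_setT (I : eqType) : @cylinders I setT.
Proof. by exists [::], (fun=> setT); split => //; apply/seteqP; split. Qed.

Lemma cylinders_setI (I : eqType) : setI_closed (@cylinders I).
Proof.
move=> _ _ [s1 [A1 [m1 ->]]] [s2 [A2 [m2 ->]]].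
exists (s1 ++ s2), (fun i => (if i \in s1 then A1 i else setT) `&`
                             (if i \in s2 then A2 i else setT)); split.
  by move=> i; apply: measurableI; case: ifP.
apply/seteqP; split => x.
  by move=> [x1 x2] i _; split; case: ifPn => // ?; [exact: x1|exact: x2].
move=> h; split => i is12; have := h i; rewrite mem_cat is12 ?orbT => /(_ isT) [].
  by move=> + _.
by move=> _.
Qed.

Lemma measurable_eval (I : eqType) (i : I) :
  measurable_fun [set: families I] (fun x : families I => x i).
Proof.
move=> _ A mA; rewrite setTI; apply: sub_sigma_algebra.
exists [:: i], (fun=> A); split => //; apply/seteqP; split => x.
  by move=> xA j; rewrite inE => /eqP ->.
by apply; rewrite mem_head.
Qed.

Lemma measurable_family (I : eqType) d (T : measurableType d) (X : T -> I -> M) :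
  (forall i, measurable_fun setT (X^~ i)) ->
  measurable_fun setT (X : T -> families I).
Proof.
move=> mX; apply: (@measurability _ _ _ (families I) setT X (@cylinders I) erefl).
move=> _ [_ [s [A [mA ->]]] <-].
rewrite setTI [X in measurable X](_ : _ =
  \bigcap_(i in [set` s]) (X^~ i @^-1` A i)); last by apply/seteqP; split.
apply: fin_bigcap_measurable => // i _.
by rewrite -[X in measurable X]setTI; exact: mX.
Qed.

Lemma families_measure_unique (R : realType) (I : eqType)
    (m1 m2 : {measure set (families I) -> \bar R}) :
  (forall C, @cylinders I C -> m1 C = m2 C) -> (m1 setT < +oo)%E ->
  forall B : set (families I), measurable B -> m1 B = m2 B.
Proof.
move=> m12 fin B mB.
apply: (@measure_unique _ _ (families I) (@cylinders I) (fun=> setT) erefl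
  (@cylinders_setI I) (fun=> cylinders_setT I)) => //.
by rewrite bigcup_const.
Qed.

End families.

Section independence.
Context dM (M : measurableType dM) d (Omega : measurableType d) (R : realType)
  (P : probability Omega R).

(** Both sides are finite measures in the event on X. *)
Lemma independent_of_cylinders (I : eqType) (X : Omega -> families M I)
    (F : set Omega) : measurable_fun setT X -> measurable F ->
  (forall C, @cylinders _ M I C -> P (F `&` X @^-1` C) = (P F * P (X @^-1` C))%E) ->
  forall B : set (families M I), measurable B ->
    P (F `&` X @^-1` B) = (P F * P (X @^-1` B))%E.
Proof.
move=> mX mF cyl B mB.
have pF0 : (0 <= fine (P F))%R by rewrite fine_ge0.
pose m1 := image_measure
  (mrestr P mF) mX.
pose m2 := mscale (NngNum pF0)
  (image_measure P mX).
have PF : (fine (P F))%:E = P F by rewrite fineK// fin_num_measure.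
have m1E C : m1 C = P (F `&` X @^-1` C) by rewrite setIC.
have m2E C : m2 C = (P F * P (X @^-1` C))%E by rewrite -PF.
rewrite -m1E -m2E; apply: families_measure_unique => //.
  by move=> C cC; rewrite m1E; apply/eqP; rewrite cyl//; apply/eqP; rewrite -m2E.
by rewrite m1E preimage_setT setIT ltey_eq fin_num_measure.
Qed.

Lemma same_law_of_cylinders (I : eqType) (X1 X2 : Omega -> families M I) :
  measurable_fun setT X1 -> measurable_fun setT X2 ->
  (forall C, @cylinders _ M I C -> P (X1 @^-1` C) = P (X2 @^-1` C)) ->
  forall B : set (families M I), measurable B -> P (X1 @^-1` B) = P (X2 @^-1` B).
Proof.
move=> mX1 mX2 cyl B mB.
pose m1 := image_measure P mX1.
pose m2 := image_measure P mX2.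
apply: (@families_measure_unique _ _ _ _ m1 m2) => //.
by rewrite /m1 /= /pushforward preimage_setT ltey_eq fin_num_measure.
Qed.

End independence.

Section iid_family.
Context dM (M : measurableType dM) d (Omega : measurableType d) (R : realType)
  (P : probability Omega R) (Z : word -> Omega -> M)
  (mu : probability M R).
Hypothesis mZ : forall u, measurable_fun setT (Z u).
Hypothesis iidZ : forall (s : seq word) (A : word -> set M), uniq s ->
  (forall u, measurable (A u)) ->
  P [set w | forall u, u \in s -> A u (Z u w)] = (\prod_(u <- s) mu (A u))%E.

Definition labels (w : Omega) : families M word := fun u => Z u w.
Definition below_root (w : Omega) : families M (nat * word)%type :=
  fun p => Z (p.1 :: p.2) w.
Definition subtree (i : nat) (w : Omega) : families M word := fun u => Z (i :: u) w.

Lemma measurable_labels : measurable_fun setT labels.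
Proof. by apply: measurable_family => u; exact: mZ. Qed.

Lemma measurable_below_root : measurable_fun setT below_root.
Proof. by apply: measurable_family => u; exact: mZ. Qed.

Lemma measurable_subtree i : measurable_fun setT (subtree i).
Proof. by apply: measurable_family => u; exact: mZ. Qed.

(** The words i :: v that index [below_root] are distinct and differ from the
    root. *)
Lemma root_below_cylinder (B : set M) (s : seq (nat * word))
    (A : nat * word -> set M) : uniq s -> measurable B ->
  (forall p, measurable (A p)) ->
  P [set w | B (Z [::] w) /\ cylinder s A (below_root w)] =
  (mu B * \prod_(p <- s) mu (A p))%E.
Proof.
move=> us mB mA.
pose A' u := if u is i :: v then A (i, v) else B.
have us' : uniq ([::] :: [seq p.1 :: p.2 | p <- s]).
  rewrite cons_uniq map_inj_uniq ?us ?andbT; first by apply/mapP => -[].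
  by move=> [a b] [a' b'] /= [-> ->].
have mA' u : measurable (A' u) by case: u => [|i v] /=; [exact: mB|exact: mA].
have := iidZ us' mA'.
rewrite big_cons big_map /=; under eq_bigr do rewrite -surjective_pairing.
move=> <-.
congr (P _); apply/seteqP; split => w /=.
  move=> [Bw h] u; rewrite inE => /predU1P[->//|/mapP[p ps ->]] /=.
  by rewrite -surjective_pairing; exact: h.
move=> h; split; first by have := h [::] (mem_head _ _).
move=> p ps; have := h (p.1 :: p.2); rewrite /= -surjective_pairing; apply.
by rewrite inE; apply/orP; right; apply/mapP; exists p.
Qed.

Lemma cylinder_undup (I : eqType) (s : seq I) (A : I -> set M) :
  cylinder (undup s) A = cylinder s A.
Proof.
apply/seteqP; split => x h i; first by rewrite -mem_undup; exact: h.
by rewrite mem_undup; exact: h.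
Qed.

Lemma labels_cylinder (s : seq word) (A : word -> set M) :
  (forall u, measurable (A u)) ->
  P (labels @^-1` cylinder s A) = (\prod_(u <- undup s) mu (A u))%E.
Proof.
by move=> mA; rewrite -cylinder_undup -iidZ// undup_uniq.
Qed.

Lemma below_root_cylinder (s : seq (nat * word)) (A : nat * word -> set M) :
  uniq s -> (forall p, measurable (A p)) ->
  P (below_root @^-1` cylinder s A) = (\prod_(p <- s) mu (A p))%E.
Proof.
move=> us mA; have := @root_below_cylinder setT s A us measurableT mA.
rewrite probability_setT mul1e => <-; congr (P _).
by apply/seteqP; split => w //= [].
Qed.

Lemma root_indep_below (A : set M) (B : set (families M (nat * word)%type)) :
  measurable A -> measurable B ->
  P (Z [::] @^-1` A `&` below_root @^-1` B) = (mu A * P (below_root @^-1` B))%E.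
Proof.
move=> mA mB.
have PA : P (Z [::] @^-1` A) = mu A.
  have := @root_below_cylinder A [::] (fun=> setT) isT mA (fun=> measurableT).
  rewrite big_nil mule1 => <-; congr (P _).
  by apply/seteqP; split => w //= [].
rewrite -PA; apply: independent_of_cylinders => //.
- exact: measurable_below_root.
- by rewrite -[X in measurable X]setTI; exact: mZ.
move=> _ [s [A' [mA' ->]]]; rewrite -cylinder_undup.
rewrite below_root_cylinder ?undup_uniq// PA.
by rewrite -root_below_cylinder ?undup_uniq.
Qed.

Lemma subtrees_cylinder k (s : nat -> seq word) (A : nat -> word -> set M) :
  (forall i u, measurable (A i u)) ->
  P [set w | forall i, (i < k)%N -> cylinder (s i) (A i) (subtree i w)] =
  (\prod_(i < k) P (labels @^-1` cylinder (s i) (A i)))%E.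
Proof.
move=> mA.
pose t := [seq (i, u) | i <- iota 0 k, u <- undup (s i)].
have ut : uniq t.
  apply: allpairs_uniq_dep; first exact: iota_uniq.
    by move=> i _; exact: undup_uniq.
  by move=> [i u] [j v] _ _ /= [-> ->].
under eq_bigr do rewrite labels_cylinder//.
have := @below_root_cylinder t (fun p => A p.1 p.2) ut (fun p => mA _ _).
rewrite big_allpairs_dep /= -[k in iota 0 k]subn0 -/(index_iota 0 k) big_mkord.
move=> <-; congr (P _); apply/seteqP; split => w /=.
  move=> h p /allpairsPdep[i [u [+ + ->]]].
  rewrite mem_iota mem_undup /= add0n => ik us.
  exact: h.
move=> h i ik u us; apply: (h (i, u)); apply/allpairsPdep; exists i, u.
by rewrite mem_iota mem_undup /= add0n.
Qed.

Lemma subtree_same_law i (B : set (families M word)) : measurable B ->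
  P (subtree i @^-1` B) = P (labels @^-1` B).
Proof.
move=> mB; apply: same_law_of_cylinders => //.
- exact: measurable_subtree.
- exact: measurable_labels.
move=> _ [s [A [mA ->]]]; rewrite labels_cylinder// -cylinder_undup.
have uis : uniq [seq (i, u) | u <- undup s].
  by rewrite map_inj_uniq ?undup_uniq// => u v [].
have := @below_root_cylinder _ (fun p => A p.2) uis (fun p => mA _).
rewrite big_map /= => <-.
congr (P _); apply/seteqP; split => w /= h.
  by move=> p /mapP[u us ->]; exact: h.
by move=> u us; apply: (h (i, u)); apply/mapP; exists u.
Qed.

(** Arbitrary events replace cylinders one subtree at a time: for all n, the
    formula is known for measurable events in the first n subtrees and cylinders
    in the others. *)
Lemma subtrees_indep_upto n (B : nat -> set (families M word)) k :
  (forall i, measurable (B i)) ->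
  (forall i, (n <= i)%N -> @cylinders _ M _ (B i)) ->
  P [set w | forall i, (i < k)%N -> B i (subtree i w)] =
  (\prod_(i < k) P (labels @^-1` (B i)))%E.
Proof.
elim: n B => [|n IH] B mB cB.
  have /choice[s /choice[A hA]] i : exists s (A : word -> set M),
    (forall u, measurable (A u)) /\ B i = cylinder s A := cB i isT.
  have BE : B = fun i => cylinder (s i) (A i) by apply/funext => i; have [] := hA i.
  by rewrite BE; apply: subtrees_cylinder => i; have [] := hA i.
pose upd C i := if i == n then C else B i.
have mupd C i : measurable (C : set (families M word)) -> measurable (upd C i).
  by move=> mC; rewrite /upd; case: ifP.
have cupd C i : @cylinders _ M _ C -> (n <= i)%N -> @cylinders _ M _ (upd C i).
  move=> cC ni; rewrite /upd; case: (eqVneq i n) => // i_n.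
  by apply: cB; rewrite ltn_neqAle eq_sym i_n.
have mcyl C : @cylinders _ M word C -> measurable (C : set (families M word)).
  exact: sub_sigma_algebra.
have cT := @cylinders_setT _ M word.
have [kn|nk] := leqP k n.
  have := IH (upd setT) (fun i => mupd _ i (mcyl _ cT)) (fun i => cupd _ i cT).
  have updE (i : nat) : (i < k)%N -> upd setT i = B i.
    by move=> ik; rewrite /upd ltn_eqF// (leq_trans ik).
  under eq_bigr do rewrite updE//.
  move=> <-; congr (P _); apply/seteqP; split => w h i ik; move: (h i ik);
    by rewrite updE.
pose F := [set w | forall i, (i < k)%N -> upd setT i (subtree i w)].
have FE C : [set w | forall i, (i < k)%N -> upd C i (subtree i w)] =
    F `&` subtree n @^-1` C.
  apply/seteqP; split => w.
    move=> h; split; last by have := h n nk; rewrite /upd eqxx.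
    by move=> i ik; have := h i ik; rewrite /upd; case: ifP.
  move=> [h hC] i ik; have := h i ik; rewrite /upd; case: (eqVneq i n) => // -> _.
  exact: hC.
have prodE C : (\prod_(i < k) P (labels @^-1` upd C i) = P (labels @^-1` C) *
    \prod_(i < k | i != Ordinal nk) P (labels @^-1` B i))%E.
  rewrite (bigD1 (Ordinal nk))//= /upd eqxx; congr (_ * _)%E.
  by apply: eq_bigr => i ni; rewrite ifN.
have PF : P F = (\prod_(i < k | i != Ordinal nk) P (labels @^-1` B i))%E.
  rewrite (IH (upd setT) (fun i => mupd _ i (mcyl _ cT)) (fun i => cupd _ i cT)).
  by rewrite prodE preimage_setT probability_setT mul1e.
have -> : [set w | forall i, (i < k)%N -> B i (subtree i w)] =
    F `&` subtree n @^-1` (B n).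
  rewrite -FE; apply/seteqP; split => w h i ik; have := h i ik;
    by rewrite /upd; case: eqVneq => // ->.
have mF : measurable F.
  rewrite (_ : F = \bigcap_(i in `I_k) (subtree i @^-1` upd setT i)); last first.
    by apply/seteqP; split.
  apply: fin_bigcap_measurable => // i _.
  rewrite -[X in measurable X]setTI; apply: measurable_subtree => //.
  exact: mupd (mcyl _ cT).
rewrite (independent_of_cylinders (@measurable_subtree n) mF)//; last first.
  move=> C cC; rewrite -FE.
  rewrite (IH (upd C) (fun i => mupd _ i (mcyl _ cC)) (fun i => cupd _ i cC)).
  by rewrite prodE -PF (subtree_same_law n (mcyl _ cC)) muleC.
rewrite (subtree_same_law n (mB n)) PF muleC -prodE; apply: eq_bigr => i _.
by rewrite /upd; case: eqVneq => // ->.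
Qed.

Lemma subtrees_indep (B : nat -> set (families M word)) k :
  (forall i, measurable (B i)) ->
  P [set w | forall i, (i < k)%N -> B i (subtree i w)] =
  (\prod_(i < k) P (labels @^-1` (B i)))%E.
Proof.
move=> mB; pose B' i := if (i < k)%N then B i else setT.
have := @subtrees_indep_upto k B' k.
under [in X in _ = X]eq_bigr do rewrite /B' ltn_ord.
move=> <-; last 2 first.
- by move=> i; rewrite /B'; case: ifP.
- by move=> i ki; rewrite /B' ltnNge ki; exact: cylinders_setT.
by congr (P _); apply/seteqP; split => w h i ik; move: (h i ik); rewrite /B' ik.
Qed.

End iid_family.

(** * The event that a labelled tree exceeds a level *)

Section exceedance.
Variable R : realType.
Local Notation M := (mark R).
Implicit Types (x : word -> M) (v : word) (r : R).

(** A boolean and explicit form of membership in [tree], from which measurability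
    is visible. *)
Definition alive x v : bool :=
  [forall k : 'I_(size v), (nth 0 v k < size (atoms (x (take k v))))%N].

Definition location x v : R := position (fun u x => x u) v x.

Definition exceed r : set (word -> M) :=
  [set x | exists v, alive x v && (r < location x v)].

Lemma alive_rcons x v j :
  alive x (rcons v j) = alive x v && (j < size (atoms (x v)))%N.
Proof.
have H (k : nat) : (k < size v)%N ->
    take k (rcons v j) = take k v /\ nth 0 (rcons v j) k = nth 0 v k.
  by move=> kv; rewrite -cats1 takel_cat ?(ltnW kv)// nth_cat kv.
apply/forallP/andP => [h|[/forallP h hj] k].
  split.
    apply/forallP => k.
    have ks : (k < size (rcons v j))%N by rewrite size_rcons ltnW// ltnS.
    by have := h (Ordinal ks) => /=; have [-> ->] := H k (ltn_ord k).
  have ks : (size v < size (rcons v j))%N by rewrite size_rcons.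
  have := h (Ordinal ks) => /=.
  by rewrite -cats1 take_size_cat// nth_cat ltnn subnn.
have := ltn_ord k; rewrite {2}size_rcons ltnS leq_eqVlt => /predU1P[->|kv].
  by rewrite -cats1 take_size_cat// nth_cat ltnn subnn.
by have [-> ->] := H k kv; exact: (h (Ordinal kv)).
Qed.

Lemma treeP (Omega : Type) (Z : word -> Omega -> M) w v :
  tree Z w v <-> alive (fun u => Z u w) v.
Proof.
split; first by elim => [|u j _ au ju]; [apply/forallP => -[]|rewrite alive_rcons au].
elim/last_ind: v => [_|v j IH]; first exact: tree_root.
by rewrite alive_rcons => /andP[/IH tv jv]; exact: tree_child.
Qed.

Lemma exceedP (Omega : Type) (Z : word -> Omega -> M) w r :
  (r%:E < max_displacement Z w)%E <-> exceed r (fun u => Z u w).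
Proof.
split.
  move=> /ereal_sup_gt[_ [v tv <-]]; rewrite lte_fin => rv.
  by exists v; rewrite rv andbT; exact/treeP.
move=> [v /andP[/treeP tv rv]]; apply: (@lt_le_trans _ _ (position Z v w)%:E).
  by rewrite lte_fin.
by apply: ereal_sup_ubound; exists v.
Qed.

Lemma alive_cons x i v : alive x (i :: v) =
  (i < size (atoms (x [::])))%N && alive (fun u => x (i :: u)) v.
Proof.
apply/forallP/andP => [h|[hi /forallP h] [[|k] //= kv]]; last first.
  exact: (h (Ordinal (kv : (k < size v)%N))).
split; first exact: (h ord0).
by apply/forallP => k; have := h (lift ord0 k).
Qed.

Lemma location_cons x i v : location x (i :: v) =
  nth 0 (atoms (x [::])) i + location (fun u => x (i :: u)) v.
Proof. by rewrite /location /position /= big_ord_recl /=. Qed.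

Lemma location_nil x : location x [::] = 0.
Proof. exact: position_root. Qed.

Lemma exceed_lt0 r x : r < 0 -> exceed r x.
Proof.
by move=> r0; exists [::]; rewrite location_nil r0 andbT; apply/forallP => -[].
Qed.

Lemma exceed_le r s x : r <= s -> exceed s x -> exceed r x.
Proof. by move=> rs [v /andP[av sv]]; exists v; rewrite av (le_lt_trans rs). Qed.

(** The root itself sits at 0, and therefore never exceeds r >= 0. *)
Lemma exceed_branch r x : 0 <= r ->
  (~ exceed r x) <-> forall i, (i < size (atoms (x [::])))%N ->
    ~ exceed (r - nth 0 (atoms (x [::])) i) (fun u => x (i :: u)).
Proof.
move=> r0; split => [h i ix [v /andP[av rv]]|h [[|i v]]].
- by apply: h; exists (i :: v); rewrite alive_cons ix av location_cons /= -ltrBlDl.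
- by rewrite location_nil ltNge r0 andbF.
- rewrite alive_cons location_cons => /andP[/andP[ix av]]; rewrite -ltrBlDl => rv.
  by apply: (h i ix); exists v; rewrite av.
Qed.

Lemma measurable_atoms d (T : measurableType d) (f : T -> M) :
  measurable_fun setT f -> measurable_fun setT (fun t => atoms (f t) : atom_seq R).
Proof.
move=> mf.
have m1 : measurable_fun setT (fun t => (f t).1) := measurableT_comp measurable_fst mf.
exact: (measurableT_comp measurable_fst m1).
Qed.

Lemma measurable_nth_atoms d (T : measurableType d) (f : T -> M) i :
  measurable_fun setT f -> measurable_fun setT (fun t => nth 0 (atoms (f t)) i).
Proof.
move=> mf; apply: (@measurable_atoms_fun _ _ _ _ (measurable_atoms mf) (fun s => nth 0 s i)).
move=> n; have [i_n|i_n] := ltnP i n.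
  rewrite (_ : (fun t => _) = fun t : n.-tuple R => tnth t (Ordinal i_n)).
    exact: measurable_tnth.
  by apply/funext => t; rewrite (tnth_nth 0).
rewrite (_ : (fun t => _) = cst 0); first exact: measurable_cst.
by apply/funext => t; rewrite nth_default// size_tuple.
Qed.

(** Both the level and the labels may depend on t: in the branching equation the
    level of a subtree is shifted by the displacement of its root. *)
Lemma measurable_exceed d (T : measurableType d) (f : T -> R) (x : T -> word -> M) :
  measurable_fun setT f -> (forall u, measurable_fun setT (x^~ u)) ->
  measurable [set t | exceed (f t) (x t)].
Proof.
move=> mf mx; rewrite (_ : [set t | _] = \bigcup_v
    ([set t | alive (x t) v] `&` [set t | f t < location (x t) v])); last first.
  apply/seteqP; split => t; first by move=> [v /andP[]]; exists v.
  by move=> [v _ [av fv]]; exists v; rewrite av.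
apply: countable_bigcupT_measurable => [|v]; first exact: countableP.
apply: measurableI.
  rewrite (_ : [set t | _] = \bigcap_(k in [set` enum 'I_(size v)])
    [set t | (nth 0%N v k < size (atoms (x t (take k v))))%N]); last first.
    apply/seteqP; split => t; first by move=> /forallP h k _; exact: h.
    by move=> h; apply/forallP => k; apply: h; rewrite /= mem_enum.
  apply: fin_bigcap_measurable => // k _.
  have := @measurable_size_atoms R _ _ _ (measurable_atoms (mx (take k v))).
  move=> /(_ measurableT [set n | (nth 0 v k < n)%N] I).
  by rewrite setTI.
have ml : measurable_fun setT (fun t => location (x t) v).
  apply: measurable_sum => k; exact: measurable_nth_atoms.
have := measurable_fun_ltr mf ml measurableT (I : measurable [set true]).
by rewrite setTI; congr measurable; apply/seteqP; split.
Qed.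

End exceedance.

(** * The branching equation *)

Section branching_equation.
Context (R : realType) d (Omega : measurableType d) (P : probability Omega R)
  (Z : word -> Omega -> mark R) (mu : probability (mark R) R).
Hypothesis mZ : forall u, measurable_fun setT (Z u).
Hypothesis iidZ : forall (s : seq word) (A : word -> set (mark R)), uniq s ->
  (forall u, measurable (A u)) ->
  P [set w | forall u, u \in s -> A u (Z u w)] = (\prod_(u <- s) mu (A u))%E.

Definition overshoot r : set Omega := [set w | exceed r (Z^~ w)].

Definition tail r : R := fine (P (overshoot r)).

Lemma measurable_overshoot r : measurable (overshoot r).
Proof. by apply: measurable_exceed => //; exact: measurable_cst. Qed.

Lemma tail_itv r : 0 <= tail r <= 1.
Proof.
rewrite /tail fine_ge0//= -lee_fin fineK ?fin_num_measure//; last first.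
  exact: measurable_overshoot.
by apply: probability_le1; exact: measurable_overshoot.
Qed.

Lemma tail_nonincreasing r s : r <= s -> tail s <= tail r.
Proof.
move=> rs; apply: fine_le; rewrite ?fin_num_measure//; try exact: measurable_overshoot.
apply: le_measure; rewrite ?inE; try exact: measurable_overshoot.
by move=> w; exact: exceed_le.
Qed.

Lemma tail_lt0 r : r < 0 -> tail r = 1.
Proof.
move=> r0; rewrite /tail (_ : overshoot r = setT) ?probability_setT//.
by apply/seteqP; split => // w _; exact: exceed_lt0.
Qed.

Lemma no_overshoot_prob r : P (~` overshoot r) = (1 - tail r)%:E.
Proof.
have mr := measurable_overshoot r.
by rewrite probability_setC// /tail EFinB fineK// fin_num_measure.
Qed.

(** The joint law of the root label and of the labels below it is a product measure
    ([root_indep_below]); the section of the event at a root label m is an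
    intersection of independent events, one for each subtree
    ([subtrees_indep]). *)
Lemma no_overshoot_branch r : 0 <= r ->
  P (~` overshoot r) =
  (\int[mu]_m (\prod_(a <- (atoms m : seq R)) (1 - tail (r - a)))%:E)%E.
Proof.
move=> r0.
pose B y : set (families (mark R) word) := ~` [set x | exceed y x].
have mB y : measurable (B y).
  apply: measurableC; apply: measurable_exceed; first exact: measurable_cst.
  by move=> u; exact: measurable_eval.
pose T2 := families (mark R) (nat * word)%type.
pose E : set (mark R * T2) := [set p | forall i, (i < size (atoms p.1))%N ->
  B (r - nth 0 (atoms p.1) i) (fun u => p.2 (i, u))].
have mE : measurable E.
  have -> : E = \bigcap_i ~` ([set p | (i < size (atoms p.1))%N] `&`
      [set p | exceed (r - nth 0 (atoms p.1) i) (fun u => p.2 (i, u))]).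
    apply/seteqP; split => p Ep.
      by move=> i _ [/= ip]; exact: (Ep i ip).
    by move=> i ip ep; exact: (Ep i I (conj ip ep)).
  apply: bigcapT_measurable => i; apply: measurableC; apply: measurableI.
    have := @measurable_size_atoms R _ _ _
      (measurable_atoms (@measurable_fst _ _ (mark R) T2)).
    by move=> /(_ measurableT [set n | (i < n)%N] I); rewrite setTI.
  apply: measurable_exceed.
    apply: measurable_funB; first exact: measurable_cst.
    by apply: measurable_nth_atoms; exact: measurable_fst.
  move=> u.
  exact: (measurableT_comp (@measurable_eval _ (mark R) _ (i, u)) measurable_snd).
have mW := measurable_below_root mZ.
pose W : {mfun Omega >-> T2} := mfun_Sub (mem_set mW).
have mZW : measurable_fun setT (fun w => (Z [::] w, below_root Z w) : mark R * T2).
  by apply: measurable_fun_pair => //; exact: mZ.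
pose joint := image_measure P mZW.
have -> : P (~` overshoot r) = joint E.
  congr (P _); apply/seteqP; split => w.
    by move=> /(exceed_branch _ r0).
  by move=> h; apply/(exceed_branch _ r0).
rewrite -(@product_measure_unique _ _ _ _ _ mu (distribution P W) joint)//; last first.
  move=> A1 A2 mA1 mA2.
  transitivity (mu A1 * P (below_root Z @^-1` A2))%E; last by [].
  by rewrite -(root_indep_below mZ iidZ mA1 mA2).
apply: eq_integral => m _ /=.
have -> : xsection E m = [set p | forall i, (i < size (atoms m))%N ->
    B (r - nth 0 (atoms m) i) (fun u => p (i, u))].
  apply/seteqP; split => p; first by move=> /xsectionP.
  by move=> Ep; apply/xsectionP.
transitivity (P [set w | forall i, (i < size (atoms m))%N ->
    B (r - nth 0 (atoms m) i) (subtree Z i w)]); first by [].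
rewrite (subtrees_indep mZ iidZ (size (atoms m)) (fun i => mB (r - nth 0 (atoms m) i))).
rewrite (big_nth 0) big_mkord.
elim/big_ind2 : _ => // [x1 x2 y1 y2 -> ->|i _]; first by rewrite EFinM.
exact: no_overshoot_prob.
Qed.

End branching_equation.

(** * Moments of a reproduction scheme *)

Section point_process.
Variable R : realType.
Implicit Types m : mark R.

Lemma point_measure_setT m : point_measure m [set: R] = (natoms (atoms m))%:E.
Proof.
rewrite /point_measure /= /msum /natoms.
rewrite (eq_bigr (fun=> 1%E)) => [|i _]; last exact: diracT.
by rewrite sumEFin big_const_ord iter_addr_0.
Qed.

Lemma ge0_integral_point_measure m (f : R -> R) : measurable_fun setT f ->
  (forall x, 0 <= f x) ->
  (\int[point_measure m]_x (f x)%:E = (\sum_(a <- atoms m) f a)%:E)%E.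
Proof.
move=> mf f0; rewrite /point_measure ge0_integral_measure_sum//; first last.
- exact/measurable_EFinP.
- by move=> x _; rewrite lee_fin.
rewrite (big_nth 0) big_mkord -sumEFin; apply: eq_bigr => i _.
by rewrite integral_dirac// ?diracT ?mul1e//; exact/measurable_EFinP.
Qed.

(** The sign of f being arbitrary, positive and negative parts are integrated
    separately. *)
Lemma integral_point_measure m (f : R -> R) : measurable_fun setT f ->
  (\int[point_measure m]_x (f x)%:E = (\sum_(a <- atoms m) f a)%:E)%E.
Proof.
move=> mf; rewrite integralE.
have -> : ((fun x => (f x)%:E)^\+)%E = EFin \o (fun x => Num.max (f x) 0).
  by apply/funext => x; rewrite funeposE /= EFin_max.
have -> : ((fun x => (f x)%:E)^\-)%E = EFin \o (fun x => Num.max (- f x) 0).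
  by apply/funext => x; rewrite funenegE /= EFin_max.
rewrite !(ge0_integral_point_measure m).
- rewrite -EFinB -sumrB; congr (_%:E); apply: eq_bigr => a _.
  by case: (leP (f a) 0) => fa; rewrite [in Num.max (- _) _]/Num.max; case: ltP; lra.
- by apply: measurable_maxr => //; exact: measurableT_comp.
- by move=> x; rewrite le_max lexx orbT.
- exact: measurable_maxr.
- by move=> x; rewrite le_max lexx orbT.
Qed.

Lemma le_measure_sup m a : a \in atoms m ->
  (a%:E <= measure_sup (point_measure m))%E.
Proof.
move=> am; apply: ereal_sup_ubound; exists a => // U [oU Ua].
rewrite /point_measure /= /msum.
have im : (index a (atoms m) < size (atoms m))%N by rewrite index_mem.
rewrite (bigD1 (Ordinal im))//= nth_index// diracE mem_set//.
by rewrite (@lt_le_trans _ _ 1%E)// leeDl// sume_ge0.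
Qed.

End point_process.

Section scheme.
Context (R : realType) d (Omega : measurableType d) (P : probability Omega R)
  (Y : {RV P >-> mark R}).

Let xs o : atom_seq R := atoms (Y o).

Lemma measurable_scheme_atoms : measurable_fun setT xs.
Proof. by apply: measurable_atoms. Qed.

Let mxs := measurable_scheme_atoms.

Lemma ge0_expect (f : Omega -> R) (c : R) : measurable_fun setT f ->
  (forall o, 0 <= f o) -> (\int[P]_w (f w)%:E = c%:E)%E ->
  Rintegrable P f /\ expect P f = c.
Proof.
move=> mf f0 fc; split; last by rewrite /expect /Rintegral fc.
apply/integrableP; split; first exact/measurable_EFinP.
under eq_integral do rewrite /= ger0_norm//.
by rewrite fc ltry.
Qed.

Lemma natoms_moments (var_n : R) :
  (\int[P]_w point_measure (Y w) [set: R] = 1)%E ->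
  (\int[P]_w (point_measure (Y w) [set: R]) ^+ 2 = (var_n + 1)%:E)%E ->
  [/\ Rintegrable P (fun o => natoms (xs o)),
      expect P (fun o => natoms (xs o)) = 1,
      Rintegrable P (fun o => natoms (xs o) ^+ 2) &
      expect P (fun o => natoms (xs o) ^+ 2) = var_n + 1].
Proof.
move=> h1 h3.
have {}h1 : (\int[P]_w (natoms (xs w))%:E = 1%:E)%E.
  by rewrite -h1; apply: eq_integral => w _; rewrite point_measure_setT.
have {}h3 : (\int[P]_w (natoms (xs w) ^+ 2)%:E = (var_n + 1)%:E)%E.
  by rewrite -h3; apply: eq_integral => w _; rewrite point_measure_setT EFin_expe.
have mN := measurable_natoms mxs.
have [iN EN] := ge0_expect mN (fun=> ler0n _ _) h1.
have [iNN ENN] := ge0_expect (measurable_funX 2 mN) (fun o => sqr_ge0 _) h3.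
by split.
Qed.

(** Integrability of the sum of the X_i comes from |x| <= 1 + x^2. *)
Lemma displacement_moments (var_x : R) :
  Rintegrable P (fun o => natoms (xs o)) ->
  (\int[P]_w \int[point_measure (Y w)]_x x%:E = 0)%E ->
  (\int[P]_w \int[point_measure (Y w)]_x (x ^+ 2)%:E = var_x%:E)%E ->
  [/\ Rintegrable P (fun o => power_sum 1 (xs o)),
      expect P (fun o => power_sum 1 (xs o)) = 0,
      Rintegrable P (fun o => power_sum 2 (xs o)) &
      expect P (fun o => power_sum 2 (xs o)) = var_x].
Proof.
move=> iN h2 h4.
have {}h4 : (\int[P]_w (power_sum 2 (xs w))%:E = var_x%:E)%E.
  rewrite -h4; apply: eq_integral => w _.
  by rewrite (integral_point_measure _ (exprn_measurable 2)).
have [i2 E2] := ge0_expect (measurable_power_sum mxs 2) (fun o => power_sum2_ge0 _) h4.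
split => //.
  apply: Rintegrable_le (RintegrableD iN i2); first exact: measurable_power_sum.
  move=> o; have e1 := sum_quadratic (xs o) 1 1 1.
  have e2 := sum_quadratic (xs o) 1 (- 1) 1.
  have s1 : 0 <= \sum_(a <- (xs o : seq R)) (1 + - 1 * a + 1 * a ^+ 2).
    by apply: sumr_ge0 => a _; have := sqr_ge0 (a - 1); have := sqr_ge0 a; lra.
  have s2 : 0 <= \sum_(a <- (xs o : seq R)) (1 + 1 * a + 1 * a ^+ 2).
    by apply: sumr_ge0 => a _; have := sqr_ge0 (a + 1); have := sqr_ge0 a; lra.
  by rewrite ler_norml; apply/andP; split; lra.
transitivity (fine (\int[P]_w \int[point_measure (Y w)]_x x%:E)%E); last by rewrite h2.
rewrite /expect /Rintegral; congr (fine _).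
apply: eq_integral => o _; by rewrite (@integral_point_measure _ _ id)//.
Qed.

(** Atoms belong to the support of the point measure, so that they are almost surely
    at most the bound Lambda. *)
Lemma jump_prob_le s : {ae P, forall w, (measure_sup (point_measure (Y w))
    <= (bound (Y w))%:E)%E} ->
  expect P (fun o => jump s (xs o)) <= fine (P [set w | s < bound (Y w)]).
Proof.
move=> [A [mA A0 subA]].
have mb : measurable [set w | s < bound (Y w)].
  have mbY : measurable_fun setT (fun w => bound (Y w)).
    have m1 : measurable_fun setT (fun w => (Y w).1).
      by apply: (measurableT_comp measurable_fst).
    exact: (measurableT_comp measurable_snd m1).
  have := measurable_fun_ltr (measurable_cst s) mbY measurableT (I : measurable [set true]).
  by rewrite setTI; congr measurable; apply/seteqP; split.
have mAb := measurableU _ _ mA mb.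
have -> : fine (P [set w | s < bound (Y w)]) =
    fine (P (A `|` [set w | s < bound (Y w)])).
  by rewrite setUC measureU0.
rewrite -(setIT (A `|` _)) -integral_indic//.
apply: le_expect.
- exact: RintegrableJ.
- exact: integrable_indic.
move=> o; rewrite /jump indicE.
case: (boolP (has _ _)) => //= /hasP[a axs sa].
rewrite mem_set//=.
have [/subA|] := pselect
    (~ (measure_sup (point_measure (Y o)) <= (bound (Y o))%:E)%E).
  by left.
move=> /contrapT h; right => /=.
rewrite (lt_le_trans sa)// -lee_fin (le_trans _ h)//.
exact: le_measure_sup.
Qed.

Lemma jump_prob_littleo :
  {ae P, forall w, (measure_sup (point_measure (Y w)) <= (bound (Y w))%:E)%E} ->
  (fun r : R => fine (P [set w | r < bound (Y w)]) : R^o)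
          =o_ (pinfty_nbhs R) (fun r : R => r ^- 4 : R^o) ->
  forall e, 0 < e -> exists s0, forall s, s0 <= s ->
    s ^+ 4 * expect P (fun o => jump s (xs o)) <= e.
Proof.
move=> hae /eqoP ho e e0.
have [s0 [_ hs]] := ho e e0.
exists (Num.max (s0 + 1) 1) => s; rewrite ge_max => /andP[s0s s1].
have s40 : 0 < s ^+ 4 by rewrite exprn_gt0//; lra.
have /= := hs s ltac:(lra).
rewrite [`|s ^- 4|]gtr0_norm ?invr_gt0// ger0_norm ?fine_ge0// ler_pdivlMr//.
by apply: le_trans; rewrite mulrC ler_pM2r//; exact: jump_prob_le.
Qed.

End scheme.

Theorem corollary2 (R : realType)
  (d0 : measure_display) (Omega0 : measurableType d0)
  (P0 : probability Omega0 R) (Y : {RV P0 >-> mark R})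
  (d : measure_display) (Omega : measurableType d)
  (P : probability Omega R) (Z : word -> {RV P >-> mark R})
  (sigma eta : R)
  (hS : reproduction_scheme Y)
  (hZ : iid_copies Y Z)
  (h1 : (\int[P0]_w point_measure (Y w) [set: R] = 1)%E)
  (h2 : (\int[P0]_w \int[point_measure (Y w)]_x x%:E = 0)%E)
  (h3 : (\int[P0]_w (point_measure (Y w) [set: R]) ^+ 2
           = (sigma ^+ 2 + 1)%:E)%E)
  (h3gt1 : 1 < sigma ^+ 2 + 1)
  (h4 : (\int[P0]_w \int[point_measure (Y w)]_x (x ^+ 2)%:E
           = (eta ^+ 2)%:E)%E)
  (h4gt0 : 0 < eta ^+ 2)
  (h5 : (fun r : R => fine (P0 [set w | r < bound (Y w)]) : R^o)
          =o_ (pinfty_nbhs R) (fun r : R => r ^- 4 : R^o))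
  (h6 : (\int[P0]_w (decoration (Y w))%:E = 1)%E) :
  (fun r : R => fine (P [set w | (r%:E < max_displacement Z w)%E]) : R^o)
    ~_(pinfty_nbhs R)
  (fun r : R => 6 * eta ^+ 2 / (sigma ^+ 2 * r ^+ 2) : R^o).
Proof.
have [_ hsup _] := hS.
have [iN EN iNN ENN] := natoms_moments h1 h3.
have [iS1 ES1 iS2 ES2] := displacement_moments iN h2 h4.
have tailJ := jump_prob_littleo hsup h5.
have mxs := measurable_scheme_atoms Y.
have sigma2_gt0 : 0 < sigma ^+ 2 by rewrite -(ltrD2r 1) add0r.
have [law indep] := hZ.
pose mu := distribution P0 Y.
have mZ u : measurable_fun setT (Z u) by [].
have iidZ (s : seq word) (A : word -> set (mark R)) : uniq s ->
    (forall u, measurable (A u)) ->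
    P [set w | forall u, u \in s -> A u (Z u w)] = (\prod_(u <- s) mu (A u))%E.
  move=> us mA; transitivity (P (\bigcap_(u in [set` s]) (Z u @^-1` A u))).
    by congr (P _); apply/seteqP; split.
  by rewrite indep//; apply: eq_bigr => u _; exact: law.
pose v := tail P Z.
have pv : profile v.
  by split; [exact: tail_nonincreasing|exact: tail_itv].
have v_fix r : 0 <= r -> reproduce P0 (fun o => atoms (Y o)) v r = v r.
  move=> r0; have iP := Rintegrable_reproduce P0 mxs r pv.
  have := no_overshoot_branch mZ iidZ r0.
  rewrite no_overshoot_prob// ge0_integral_distribution; first last.
  - move=> m; rewrite lee_fin.
    have w01 : {in atoms m, forall a, 0 <= v (r - a) <= 1}.
      by move=> a _; exact: pv.2.
    by have /andP[] := prod_1B_itv w01.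
  - apply/measurable_EFinP.
    have mid : measurable_fun setT (fun m : mark R => m) by exact: measurable_id.
    apply: (measurable_prod_atoms (measurable_atoms mid) (g := fun a => 1 - v (r - a))).
    apply: nonincreasing_measurable => // x y xy.
    by rewrite lerD2l lerN2 pv.1// lerD2l lerN2.
  move=> /(congr1 fine) /= E.
  have : expect P0 (fun o =>
      1 - (1 - \prod_(a <- atoms (Y o)) (1 - v (r - a)))) = 1 - v r.
    by rewrite /v E; congr fine; apply: eq_integral => o _; rewrite subKr.
  rewrite expectB ?expect_cst//; last exact: Rintegrable_cst.
  by rewrite /reproduce => h; apply: (addrI (- 1)); lra.
have -> : (fun r : R => fine (P [set w | (r%:E < max_displacement Z w)%E])) = v.
  apply/funext => r; congr (fine (P _)); apply/seteqP; split => w.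
    by move=> /(exceedP (fun u => Z u)).
  by move=> h; apply/(exceedP (fun u => Z u)).
have -> : (fun r : R => 6 * eta ^+ 2 / (sigma ^+ 2 * r ^+ 2)) =
    (fun r => 6 * eta ^+ 2 / sigma ^+ 2 / r ^+ 2).
  by apply/funext => r; rewrite invfM mulrA.
apply: equiv_inv_sqr.
- by rewrite divr_gt0// mulr_gt0.
- move=> k kc; apply: (upper_envelope mxs iN EN iNN ENN iS1 ES1 iS2 ES2) => //.
    by apply: lt_trans kc; rewrite divr_gt0// mulr_gt0.
  by rewrite -ltr_pdivrMr.
- move=> k k0 kc; apply: (lower_envelope mxs iN EN iNN ENN iS1 ES1 iS2 ES2) => //.
    exact: tail_lt0.
  by rewrite -ltr_pdivlMr.
Qed.
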